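(* Let $W$ be a finite irreducible (real) reflection group of rank $n$ acting on the real vector space $V$, with root system $\Phi$ and Coxeter number $h$. Let $b$ be a positive integer and let $x\in V_{\mathbb{C}}=V\otimes_{\mathbb{R}}\mathbb{C}$ be an eigenvector for an element of $W$ with eigenvalue a primitive $b^{\mathrm{th}}$ root of unity (that is, $x\neq 0$ and $w\cdot x=\lambda x$ for some $w\in W$ and some primitive $b^{\mathrm{th}}$ root of unity $\lambda\in\mathbb{C}$). Then $$N(x)\geq bn,$$ where $N(x)=|\{\alpha\in\Phi \mid (\alpha,x)\neq 0\}|$. Moreover, equality $N(x)=bn$ is achieved if and only if $b=h$.
   Context: $V$ is a finite dimensional real vector space with a positive definite symmetric bilinear form $(\cdot,\cdot)$, and $W$ is a finite subgroup of $\mathrm{GL}(V)$ generated by reflections that are orthogonal with respect to this form. The root system $\Phi$ of $W$ is taken in the sense used for reflection groups: a finite $W$-stable set of nonzero vectors, all of the same length, consisting of exactly two opposite vectors $\pm\alpha$ for each reflection $s_\alpha\in W$. No crystallographic condition is imposed. $\Phi$ is assumed irreducible and spans $V$. The rank of $W$ is $n=\dim V$. The form $(\cdot,\cdot)$ is extended $\mathbb{C}$-bilinearly to $V_{\mathbb{C}}$, and $W$ acts $\mathbb{C}$-linearly on $V_{\mathbb{C}}$. The ring $\mathbb{R}[V]^W$ of invariant polynomials is generated by $n$ algebraically independent homogeneous polynomials whose degrees $d_1\le\cdots\le d_n$ are the degrees of $W$. The Coxeter number is $h=d_n$, which is also the order of any Coxeter element (product of all simple reflections). For $x\in V_{\mathbb{C}}$,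 let $W_x=\{w\in W\mid w\cdot x=x\}$ be its stabiliser and $\Phi_x\subseteq\Phi$ the root system of $W_x$. Then $N(x):=|\Phi|-|\Phi_x|$, equivalently $N(x)=|\{\alpha\in\Phi\mid(\alpha,x)\neq0\}|$. *)

(* Defs.v *)
From HB Require Import structures.
From mathcomp Require Import all_boot all_order all_algebra.
From mathcomp Require Import sesquilinear finmap complex reals mpoly.

Set Implicit Arguments.
Unset Strict Implicit.
Unset Printing Implicit Defensive.

Import Order.TTheory GRing.Theory Num.Theory.
Local Open Scope ring_scope.
Local Open Scope complex_scope.

(* The pair (u, v) stands for u (x) 1 + v (x) i in the tensor product of V with
   the complex numbers. *)
Definition complexification (R : rcfType) (V : vectType R) : Type :=
  (V * V)%type.

HB.instance Definition _ (R : rcfType) (V : vectType R) :=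
  GRing.Zmodule.copy (complexification V) (V * V)%type.

Definition cscale (R : rcfType) (V : vectType R) (c : R[i])
    (x : complexification V) : complexification V :=
  let: a +i* b := c in (a *: x.1 - b *: x.2, b *: x.1 + a *: x.2).

Section ComplexificationLmodule.
Variables (R : rcfType) (V : vectType R).

Fact cscaleA (c d : R[i]) (x : complexification V) :
  cscale c (cscale d x) = cscale (c * d) x.
Proof.
case: c d x => [a b] [a' b'] [u v]; rewrite /cscale /=.
rewrite !scalerBr !scalerDr !scalerBl !scalerDl !scalerA.
congr pair; first by rewrite opprD addrACA opprD.
by rewrite addrACA; congr (_ + _); rewrite addrC.
Qed.

Fact cscale1 : left_id 1 (@cscale R V).
Proof. by case=> u v; rewrite /cscale /= !scale1r !scale0r subr0 add0r. Qed.

Fact cscaleDr : right_distributive (@cscale R V) +%R.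
Proof.
case=> a b [u v] [u' v']; rewrite /cscale /=.
by congr pair; rewrite !scalerDr ?opprD addrACA.
Qed.

Fact cscaleDl (x : complexification V) :
  {morph (@cscale R V)^~ x : c d / c + d}.
Proof.
case: x => u v [a b] [a' b']; rewrite /cscale /=.
by congr pair; rewrite !scalerDl ?opprD addrACA.
Qed.

End ComplexificationLmodule.

HB.instance Definition _ (R : rcfType) (V : vectType R) :=
  GRing.Zmodule_isLmodule.Build R[i] (complexification V)
    (@cscaleA R V) (@cscale1 R V) (@cscaleDr R V) (@cscaleDl R V).

Definition cembed (R : rcfType) (V : vectType R) (v : V) :
  complexification V := (v, 0).

Definition cextend (R : rcfType) (V : vectType R) (w : 'End(V))
    (x : complexification V) : complexification V := (w x.1, w x.2).

(* The C-bilinear (not the Hermitian) extension of the form. *)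
Definition cform (R : rcfType) (V : vectType R) (B : {dot V for idfun})
    (x y : complexification V) : R[i] :=
  (B x.1 y.1 - B x.2 y.2) +i* (B x.1 y.2 + B x.2 y.1).

Section ReflectionGroups.
Variables (R : rcfType) (V : vectType R) (B : {dot V for idfun}).
Implicit Types (W : {fset 'End(V)}) (Phi : {fset V}).

Definition finite_linear_group W : Prop :=
  [/\ \1%VF \in W,
      forall g g', g \in W -> g' \in W -> (g \o g')%VF \in W &
      forall g, g \in W ->
        exists2 g', g' \in W & (g \o g' = \1)%VF /\ (g' \o g = \1)%VF].

Definition reflection_along (a : V) (s : 'End(V)) : Prop :=
  a != 0 /\ forall v, s v = v - (2 * B a v / B a a) *: a.

Definition reflection (s : 'End(V)) : Prop :=
  exists a, reflection_along a s.

Definition finite_reflection_group W : Prop :=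
  finite_linear_group W /\
  forall g, g \in W -> exists2 ss : seq 'End(V),
    forall s, s \in ss -> s \in W /\ reflection s &
    g = \big[@comp_lfun R V V V / \1%VF]_(s <- ss) s.

Definition root_system_of W Phi : Prop :=
  [/\ 0 \notin Phi,
      forall w a, w \in W -> a \in Phi -> w a \in Phi,
      forall a a', a \in Phi -> a' \in Phi -> B a a = B a' a',
      forall a, a \in Phi -> exists2 s, s \in W & reflection_along a s &
      forall s, s \in W -> reflection s -> exists2 a, a \in Phi &
        forall a', (a' \in Phi /\ reflection_along a' s) <->
                   (a' = a \/ a' = - a)].

Definition irreducible_roots Phi : Prop :=
  Phi != fset0 /\
  ~ exists Phi1 Phi2 : {fset V},
      [/\ Phi1 != fset0, Phi2 != fset0, Phi = (Phi1 `|` Phi2)%fset &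
          forall a1 a2, a1 \in Phi1 -> a2 \in Phi2 -> B a1 a2 = 0].

(* R[V] is identified with the polynomials in the coordinate functions of a
   basis of V. *)
Definition polyval (p : {mpoly R[\dim {:V}]}) (v : V) : R :=
  p.@[fun i => coord (vbasis {:V}) i v].

Definition invariant_poly W (p : {mpoly R[\dim {:V}]}) : Prop :=
  forall w, w \in W -> forall v, polyval p (w v) = polyval p v.

Definition basic_invariants W
    (f : (\dim {:V}).-tuple {mpoly R[\dim {:V}]})
    (d : (\dim {:V}).-tuple nat) : Prop :=
  [/\ forall i, invariant_poly W (tnth f i),
      forall i, tnth f i \is (tnth d i).-homog,
      forall q : {mpoly R[\dim {:V}]}, q \mPo f = 0 -> q = 0 &
      forall p, invariant_poly W p ->
        exists q : {mpoly R[\dim {:V}]}, p = q \mPo f].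

Definition degrees W (d : (\dim {:V}).-tuple nat) : Prop :=
  sorted leq d /\ exists f, basic_invariants W f d.

(* The largest degree; it depends only on W, and it exists by Chevalley's
   theorem when W is a finite reflection group and V is nonzero. *)
Definition Coxeter_number W (h : nat) : Prop :=
  exists2 d, degrees W d & h = last 0%N d.

Definition root_count Phi (x : complexification V) : nat :=
  #|` [fset a in Phi | cform B (cembed a) x != 0]%fset |.

End ReflectionGroups.

(* Main.v *)
From HB Require Import structures.
Require Import Defs.
From mathcomp Require Import all_boot all_order all_algebra.
From mathcomp Require Import sesquilinear finmap complex reals mpoly.
From mathcomp Require Import ring lra spectral separable.
From mathcomp Require boolp cyclotomic cyclic.

Set Implicit Arguments.
Unset Strict Implicit.
Unset Printing Implicit Defensive.

Import Order.TTheory GRing.Theory Num.Theory.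
Local Open Scope ring_scope.
Local Open Scope complex_scope.

(** Write n for the dimension of V, and for w in W let U be the image of 1 - w.

    The inequality. Let w x = l x, where after passing to a power of w one may
    take l = exp (2 i pi / b), and choose such a w with U as small as possible.
    If a root a in U vanished at x, then s_a w would also multiply x by l and it
    would have a smaller U (moved_srefl); so no root of U vanishes at x. Rotate x
    so that no nonzero value (a, x) is real, and order the roots by the real
    vector p = M p0 + Im x, where p0 is a generic vector fixed by w and M is
    large. The inversions of w for p are roots in U, and for them (a, x) lies in a
    sector of angle 2 pi / b; as w multiplies these values by b-th roots of unity,
    the translates of the set of inversions by 1, w, ..., w^(b - 1) are disjoint.
    Now w is a product of as many reflections as it has inversions
    (reduced_word), and each reflection moves only a line, so there are at least
    dim U inversions: U contains at least b dim U roots not vanishing at x. By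
    irreducibility the roots that do not vanish at x span V (support_span);
    n - dim U of them complete U to V, and they and their opposites have
    different orbits of size at least b under w. Altogether
    N(x) >= b (dim U + 2 (n - dim U)) >= b n, and if N(x) = b n then U = V and no
    root vanishes at x (root_count_bound).

    The number of roots is h n (card_roots). On the one hand, the Coxeter graph of
    a simple system is a forest, so the simple roots fall into two classes of
    orthogonal roots, and c = c1 c2 is a product of n simple reflections. The
    Perron vector of the Gram matrix lies in the open chamber, and it gives a
    plane stable under c that is orthogonal to no root, hence an eigenvector of c
    at which no root vanishes (coxeter_eigenvector). If the eigenvalue has order
    b, then c^b = 1. As c fixes no nonzero vector, each of its orbits of roots has
    sum 0, so it contains one of the at most n inversions of c; hence there are at
    most b n roots. A homogeneous invariant of degree d that is nonzero at the
    eigenvector has b | d, so b <= h. On the other hand, the basic invariants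
    take arbitrary real values at some point of the complexification of V
    (basic_point), so all but the last of them have a common zero x where the last
    one does not vanish. Since invariants separate orbits (invariants_separate), x is an
    eigenvector whose eigenvalue has order h, and the inequality gives
    h n <= N(x), which is at most the number of roots.

    The case of equality. If N(x) = b n, then no root vanishes at x, so
    b n = h n. If b = h, then N(x) is at least h n, which is the number of
    roots. *)

Local Notation Re := (@complex.Re _).
Local Notation Im := (@complex.Im _).

(** * Sums, dimensions and counting *)

Lemma Re_sum (R : rcfType) I (r : seq I) (F : I -> R[i]) :
  Re (\sum_(i <- r) F i) = \sum_(i <- r) Re (F i).
Proof. by apply: (big_morph Re) => // -[? ?] [? ?]. Qed.

Lemma Im_sum (R : rcfType) I (r : seq I) (F : I -> R[i]) :
  Im (\sum_(i <- r) F i) = \sum_(i <- r) Im (F i).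
Proof. by apply: (big_morph Im) => // -[? ?] [? ?]. Qed.

Lemma dim_add_line (K : fieldType) (V : vectType K) (U : {vspace V}) (a : V) :
  a \notin U -> \dim (U + <[a]>)%VS = (\dim U).+1.
Proof.
move=> aU; have a0 : a != 0 by apply: contraNneq aU => ->; rewrite mem0v.
rewrite dimv_disjoint_sum ?dim_vline ?a0 ?addn1 //.
apply/eqP; rewrite -subv0; apply/subvP => u; rewrite memv_cap memv0 => /andP[uU].
case/vlineP=> c ec; rewrite ec scaler_eq0.
have [//|c0 /=] := eqVneq c 0; exfalso; case/negP: aU.
by rewrite -[a]scale1r -(mulVf c0) -scalerA -ec memvZ.
Qed.

Lemma sub_count_lt (T : eqType) (P Q : pred T) (s : seq T) x : subpred P Q ->
  x \in s -> Q x -> ~~ P x -> (count P s < count Q s)%N.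
Proof.
move=> PQ xs Qx Px; have [s1 s2] := splitPr xs.
rewrite !count_cat /= (negbTE Px) Qx add0n add1n addnS ltnS leq_add //;
  exact: sub_count.
Qed.

Lemma ex_min_measure (T : Type) (P : T -> Prop) (m : T -> nat) :
  (exists t, P t) -> exists2 t, P t & forall t', P t' -> (m t <= m t')%N.
Proof.
case=> t; have [k] := ubnP (m t); elim: k t => [//|k ih] t mt Pt.
have [[t' Pt' lt]|hn] := boolp.pselect (exists2 t', P t' & (m t' < m t)%N).
  by apply: (ih t') => //; apply: leq_trans lt _.
exists t => // t' Pt'; rewrite leqNgt; apply/negP => lt; apply: hn; by exists t'.
Qed.

(** * Reflections and the group they generate *)

Section Form.
Variables (R : rcfType) (V : vectType R) (B : {dot V for idfun}).

Lemma dotC u v : B u v = B v u.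
Proof. by rewrite hermC /= mul1r. Qed.

Lemma dotDl u v w : B (u + v) w = B u w + B v w.
Proof. exact: linearDl. Qed.
Lemma dotDr u v w : B w (u + v) = B w u + B w v.
Proof. exact: linearDr. Qed.
Lemma dotZl c u v : B (c *: u) v = c * B u v.
Proof. exact: linearZl_LR. Qed.
Lemma dotZr c u v : B u (c *: v) = c * B u v.
Proof. exact: linearZr_LR. Qed.
Lemma dotNl u v : B (- u) v = - B u v.
Proof. exact: linearNl. Qed.
Lemma dotNr u v : B u (- v) = - B u v.
Proof. exact: linearNr. Qed.
Lemma dot0l v : B 0 v = 0.
Proof. exact: linear0l. Qed.
Lemma dot0r v : B v 0 = 0.
Proof. exact: linear0r. Qed.
Lemma dot_suml I (r : seq I) (P : pred I) F v :
  B (\sum_(i <- r | P i) F i) v = \sum_(i <- r | P i) B (F i) v.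
Proof. exact: linear_sumlz. Qed.
Lemma dot_sumr I (r : seq I) (P : pred I) F v :
  B v (\sum_(i <- r | P i) F i) = \sum_(i <- r | P i) B v (F i).
Proof. exact: linear_sumr. Qed.
Lemma dot_gt0 u : (0 < B u u) = (u != 0).
Proof.
case: (eqVneq u 0) => [->|u0]; first by rewrite dot0l ltxx.
by rewrite neq0_dnorm_gt0.
Qed.
Lemma dot_eq0 u : (B u u == 0) = (u == 0).
Proof.
case: (eqVneq u 0) => [->|u0]; first by rewrite dot0l eqxx.
by apply/negbTE; rewrite gt_eqF // dot_gt0.
Qed.
Lemma dot_ge0 u : 0 <= B u u.
Proof. by rewrite le0r dot_gt0 dot_eq0; case: eqP. Qed.
End Form.

Section Reflections.
Variables (R : rcfType) (V : vectType R) (B : {dot V for idfun}).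

Definition srefl_fun (a v : V) : V := v - (2 * B a v / B a a) *: a.

Fact srefl_fun_linear a : linear (srefl_fun a).
Proof.
move=> c u v; rewrite /srefl_fun dotDr dotZr scalerBr scalerA [RHS]addrACA -opprD -scalerDl.
by congr (_ - _ *: _); ring.
Qed.
HB.instance Definition _ a :=
  GRing.isLinear.Build R V V *:%R (srefl_fun a) (@srefl_fun_linear a).

Definition srefl (a : V) : 'End(V) := linfun (srefl_fun a).

Lemma sreflE a v : srefl a v = v - (2 * B a v / B a a) *: a.
Proof. by rewrite lfunE. Qed.

Lemma srefl_id a : a != 0 -> srefl a a = - a.
Proof.
move=> a0; rewrite sreflE mulfK ?dot_eq0 //.
by rewrite scaler_nat mulr2n opprD addrA subrr add0r.
Qed.

Lemma srefl_orth a v : B a v = 0 -> srefl a v = v.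
Proof. by move=> av; rewrite sreflE av mulr0 mul0r scale0r subr0. Qed.

Lemma dot_srefl a u v : B (srefl a u) v = B u (srefl a v).
Proof.
rewrite !sreflE dotDl dotDr dotNl dotNr dotZl dotZr (dotC B u a); ring.
Qed.

Lemma srefl_isom a u v : a != 0 -> B (srefl a u) (srefl a v) = B u v.
Proof.
move=> a0; rewrite !sreflE !(dotDl, dotDr, dotNl, dotNr, dotZl, dotZr).
rewrite (dotC B u a); have : B a a != 0 by rewrite dot_eq0.
by move=> h; field.
Qed.

Lemma sreflK a : a != 0 -> involutive (srefl a).
Proof.
move=> a0 v; apply/eqP; rewrite -subr_eq0 -(dot_eq0 B).
set w := _ - v; have hw u : B w u = 0.
  by rewrite /w dotDl dotNl dot_srefl srefl_isom // subrr.
by rewrite hw.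
Qed.

Lemma sreflN a : srefl (- a) = srefl a.
Proof.
apply/lfunP => v; rewrite !sreflE !dotNl !dotNr opprK scalerN; congr (_ - _).
by rewrite mulrN mulNr scaleNr opprK.
Qed.

Lemma reflection_alongE a s : reflection_along B a s -> s = srefl a.
Proof. by case=> a0 h; apply/lfunP => v; rewrite sreflE h. Qed.

Definition word (ss : seq V) : 'End(V) :=
  foldr (fun a g => (srefl a \o g)%VF) \1%VF ss.

Lemma word_cons a ss v : word (a :: ss) v = srefl a (word ss v).
Proof. by rewrite /= comp_lfunE. Qed.

Lemma word_cat s1 s2 v : word (s1 ++ s2) v = word s1 (word s2 v).
Proof.
elim: s1 v => [|a s1 ih] v; first by rewrite /= id_lfunE.
by rewrite cat_cons !word_cons ih.
Qed.

Lemma word_sub_span ss v : word ss v - v \in <<ss>>%VS.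
Proof.
elim: ss => [|a ss ih]; first by rewrite /= id_lfunE subrr mem0v.
rewrite word_cons sreflE addrAC span_cons addrC memv_add //.
by rewrite memvN memvZ // memv_line.
Qed.

(** If s_a u = v with u the image of v under the rest of the word, then u - v is
    both a multiple of a and in the span of the other roots, hence zero. *)
Lemma word_free_fix ss v : free ss -> word ss v = v ->
  {in ss, forall a, B a v = 0}.
Proof.
elim: ss => [//|a ss ih]; rewrite free_cons word_cons => /andP[aS fS].
have a0 : a != 0 by apply: contraNneq aS => ->; rewrite mem0v.
rewrite sreflE; set u := word ss v; set k := _ / _ => e.
have kS : k *: a \in <<ss>>%VS.
  have -> : k *: a = u - v by rewrite -{1}e opprB addrCA subrr addr0.
  exact: word_sub_span.
have k0 : k = 0.
  apply/eqP; apply: contraNT aS => k0.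
  by rewrite -[a]scale1r -(mulVf k0) -scalerA memvZ.
have uv : u = v by rewrite -[in RHS]e k0 scale0r subr0.
move=> b; rewrite inE => /predU1P[->|]; last exact: ih.
move/eqP: k0; rewrite /k uv !mulf_eq0 pnatr_eq0 invr_eq0 dot_eq0 (negbTE a0).
by rewrite orbF => /eqP.
Qed.

End Reflections.

Section RootSystem.
Variables (R : rcfType) (V : vectType R) (B : {dot V for idfun}).
Variables (W : {fset 'End(V)}) (Phi : {fset V}).
Hypotheses (hW : finite_reflection_group B W) (hPhi : root_system_of B W Phi).

Lemma root_neq0 a : a \in Phi -> a != 0.
Proof. by case: hPhi => h0 *; apply: contraNneq h0 => <-. Qed.

Lemma group1W : \1%VF \in W.
Proof. by case: hW => -[]. Qed.

Lemma groupMW g g' : g \in W -> g' \in W -> (g \o g')%VF \in W.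
Proof. by case: hW => -[? h ?] _; apply: h. Qed.

Lemma rootW w a : w \in W -> a \in Phi -> w a \in Phi.
Proof. by case: hPhi => _ h *; apply: h. Qed.

Lemma srefl_inW a : a \in Phi -> srefl B a \in W.
Proof.
by case: hPhi => _ _ _ h _ /h [s sW /reflection_alongE <-].
Qed.

Lemma root_norm a a' : a \in Phi -> a' \in Phi -> B a a = B a' a'.
Proof. by case: hPhi => _ _ h *; apply: h. Qed.

Lemma root_srefl a a' : a \in Phi -> a' \in Phi -> srefl B a a' \in Phi.
Proof. by move=> aP; apply: rootW; apply: srefl_inW. Qed.

Lemma rootN a : a \in Phi -> - a \in Phi.
Proof.
by move=> aP; rewrite -(srefl_id B (root_neq0 aP)) root_srefl.
Qed.

Lemma root_scale c a : a \in Phi -> c *: a \in Phi -> c = 1 \/ c = - 1.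
Proof.
move=> aP caP; have := root_norm aP caP; rewrite dotZl dotZr => h.
have a0 : B a a != 0 by rewrite dot_eq0 root_neq0.
have /eqP : c ^+ 2 = 1.
  by apply: (mulIf a0); rewrite mul1r [RHS]h; ring.
by rewrite sqrf_eq1 => /orP[] /eqP ->; [left|right].
Qed.

Lemma word_inW ss : {subset ss <= Phi} -> word B ss \in W.
Proof.
elim: ss => [|a ss ih] h /=; first exact: group1W.
apply: groupMW; first by apply: srefl_inW; apply: h; rewrite mem_head.
by apply: ih => b bs; apply: h; rewrite inE bs orbT.
Qed.

Lemma groupW_word w : w \in W -> exists2 ss, {subset ss <= Phi} & w = word B ss.
Proof.
case: hW => _ /[apply] -[ss hss ->].
elim: ss hss => [|s ss ih] hss; first by exists [::] => //=; rewrite big_nil.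
have [|ts hts e] := ih.
  by move=> s' s's; apply: hss; rewrite inE s's orbT.
have [sW sr] := hss s (mem_head _ _).
have [_ _ _ _ /(_ s sW sr) [a aP ha]] := hPhi.
have /reflection_alongE -> : reflection_along B a s.
  by have [_] := (ha a).2 (or_introl erefl).
exists (a :: ts); last by rewrite big_cons e.
by move=> x; rewrite inE => /predU1P [->|/hts].
Qed.

Lemma groupW_isom w u v : w \in W -> B (w u) (w v) = B u v.
Proof.
case/groupW_word => ss hss ->; elim: ss u v hss => [|a ss ih] u v hss.
  by rewrite /= !id_lfunE.
rewrite !word_cons srefl_isom ?ih //; last by rewrite root_neq0 ?hss ?mem_head.
by move=> b bs; apply: hss; rewrite inE bs orbT.
Qed.

Lemma groupW_inv w : w \in W ->
  exists2 w', w' \in W & cancel w w' /\ cancel w' w.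
Proof.
case: hW => -[_ _ h] _ /h [w' w'W [e1 e2]]; exists w' => //.
by split=> v; rewrite -comp_lfunE ?e1 ?e2 id_lfunE.
Qed.

Lemma groupW_inj w : w \in W -> injective w.
Proof. by case/groupW_inv => w' _ [/can_inj]. Qed.

Fixpoint pow (w : 'End(V)) (k : nat) : 'End(V) :=
  if k is k'.+1 then (w \o pow w k')%VF else \1%VF.

Lemma pow_inW w k : w \in W -> pow w k \in W.
Proof.
by move=> wW; elim: k => [|k ih] /=; [exact: group1W | apply: groupMW].
Qed.

Lemma powE w k v : pow w k v = iter k w v.
Proof. by elim: k => [|k ih] /=; rewrite ?id_lfunE // comp_lfunE ih. Qed.

End RootSystem.

(** * Simple systems and inversions *)

Section SimpleSystem.
Variables (R : rcfType) (V : vectType R) (B : {dot V for idfun}).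
Variables (W : {fset 'End(V)}) (Phi : {fset V}).
Hypotheses (hW : finite_reflection_group B W) (hPhi : root_system_of B W Phi).
Variable p : V.
Hypothesis hp : forall a, a \in Phi -> B a p != 0.

Definition posroot (a : V) := (a \in Phi) && (0 < B a p).

Definition in_cone (D : seq V) (v : V) :=
  exists2 c : V -> R, forall d, 0 <= c d & v = \sum_(d <- D) c d *: d.

Lemma coneD D u v : in_cone D u -> in_cone D v -> in_cone D (u + v).
Proof.
case=> c c0 -> [c' c'0 ->]; exists (fun d => c d + c' d).
  by move=> d; rewrite addr_ge0.
by rewrite -big_split; apply: eq_bigr => d _; rewrite scalerDl.
Qed.

Lemma coneZ D k v : 0 <= k -> in_cone D v -> in_cone D (k *: v).
Proof.
move=> k0 [c c0 ->]; exists (fun d => k * c d).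
  by move=> d; rewrite mulr_ge0.
by rewrite scaler_sumr; apply: eq_bigr => d _; rewrite scalerA.
Qed.

Lemma cone_mem (D : seq V) d : uniq D -> d \in D -> in_cone D d.
Proof.
move=> uD dD; exists (fun e => (e == d)%:R) => [e|]; first by rewrite ler0n.
rewrite (bigD1_seq d) //= eqxx scale1r big1 ?addr0 // => e /negbTE ->.
by rewrite scale0r.
Qed.

Lemma cone_split (D : seq V) d y : uniq D -> d \in D -> in_cone D y ->
  exists t y', [/\ 0 <= t, in_cone (rem d D) y' & y = t *: d + y'].
Proof.
move=> uD dD [c c0 ->]; exists (c d), (\sum_(e <- rem d D) c e *: e); split=> //.
  by exists c.
by rewrite (big_rem _ dD).
Qed.

Lemma cone_gt0 D y : {in D, forall d, 0 < B d p} -> in_cone D y -> y != 0 ->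
  0 < B y p.
Proof.
move=> hD [c c0 ->] y0; rewrite dot_suml lt_neqAle.
have h d : d \in D -> 0 <= B (c d *: d) p.
  by move=> dD; rewrite dotZl mulr_ge0 // ltW // hD.
rewrite big_seq sumr_ge0 // andbT eq_sym psumr_neq0 //.
apply/hasP; apply: boolp.contrapT => hn; case/negP: y0; apply/eqP.
rewrite big_seq big1 // => d dD; have : ~~ (0 < B (c d *: d) p).
  by apply/negP => h1; apply: hn; exists d => //; rewrite dD.
rewrite dotZl -leNgt => h1; have : c d <= 0.
  by rewrite -(ler_pM2r (hD d dD)) mul0r.
by move=> cd; have -> : c d = 0 by [apply/le_anti; rewrite cd c0]; rewrite scale0r.
Qed.

(** Irredundancy stands in for linear independence, which follows from it in
    simple_free. Roots need not be integral combinations of simple ones here, so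
    indecomposability would not be a usable definition. *)
Definition simple_system (D : seq V) :=
  [/\ uniq D, {in D, forall d, posroot d},
      forall a, posroot a -> in_cone D a &
      forall d, d \in D -> ~ in_cone (rem d D) d].

Lemma simple_system_ex : exists D, simple_system D.
Proof.
suff H n D : (size D < n)%N -> uniq D -> {in D, forall d, posroot d} ->
    (forall a, posroot a -> in_cone D a) -> exists D', simple_system D'.
  apply: (H _ [seq a <- Phi | posroot a] (leqnn _)).
  - by rewrite filter_uniq ?fset_uniq.
  - by move=> a; rewrite mem_filter => /andP[].
  - move=> a ha; apply: cone_mem; first by rewrite filter_uniq ?fset_uniq.
    by rewrite mem_filter ha; case/andP: ha.
elim: n D => [//|n ih] D sz uD pD hD.
have [[d dD hd]|hn] := boolp.pselect (exists2 d, d \in D & in_cone (rem d D) d).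
  apply: (ih (rem d D)).
  - by rewrite size_rem //; move: sz; case: (D) dD.
  - exact: rem_uniq.
  - by move=> e /mem_rem; apply: pD.
  - move=> a /hD /(cone_split uD dD) [t [y [t0 hy ->]]].
    by apply: coneD => //; apply: coneZ.
by exists D; split=> // d dD hd; apply: hn; exists d.
Qed.

Variable D : seq V.
Hypothesis hD : simple_system D.

Let uD : uniq D. Proof. by case: hD. Qed.

Lemma simple_pos d : d \in D -> posroot d.
Proof. by case: hD => _ h _ _ /h. Qed.

Lemma simple_root d : d \in D -> d \in Phi.
Proof. by case/simple_pos/andP. Qed.

Lemma simple_gt0 d : d \in D -> 0 < B d p.
Proof. by case/simple_pos/andP. Qed.

(** The form in which irredundancy is used: after moving the d-component of y to
    the left, either d lies in the cone of the other simple roots, or pairing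
    with p gives opposite signs. *)
Lemma simple_ray d s y z : d \in D -> in_cone D y -> in_cone (rem d D) z ->
  0 < B z p -> s *: d = z + y -> False.
Proof.
move=> dD hy hz z0 e; have [t [y' [t0 hy' ey]]] := cone_split uD dD hy.
have hc : in_cone (rem d D) (z + y') by apply: coneD.
have e' : (s - t) *: d = z + y'.
  by apply/eqP; rewrite scalerBl subr_eq e ey -addrA [y' + _]addrC.
have y'0 : 0 <= B y' p.
  have [->|y'n0] := eqVneq y' 0; first by rewrite dot0l.
  apply/ltW/(cone_gt0 _ hy' y'n0) => x /mem_rem; exact: simple_gt0.
have st : 0 < s - t.
  rewrite -(pmulr_lgt0 _ (simple_gt0 dD)) -dotZl e' dotDl.
  by apply: ltr_wpDr.
case: hD => _ _ _ /(_ d dD); apply.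
have -> : in_cone (rem d D) d = in_cone (rem d D) ((s - t)^-1 *: (z + y')).
  by rewrite -e' scalerA mulVf ?scale1r // gt_eqF.
by apply: coneZ => //; rewrite invr_ge0 ltW.
Qed.

Lemma root_pos_or_neg a : a \in Phi -> posroot a \/ posroot (- a).
Proof.
move=> aP; rewrite /posroot aP (rootN hPhi) //= dotNl oppr_gt0.
by have := hp aP; case: (ltgtP 0 (B a p)) => //; [left|right].
Qed.

Lemma posroot_cone a : posroot a -> in_cone D a.
Proof. by case: hD => _ _ h _; apply: h. Qed.

(** Otherwise s_a b = b - c a with c > 0, and whichever of this root and its
    opposite is positive exhibits a or b as redundant. *)
Lemma simple_obtuse a b : a \in D -> b \in D -> a != b -> B a b <= 0.
Proof.
move=> aD bD ab; rewrite leNgt; apply/negP => h.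
have aa : 0 < B a a by rewrite dot_gt0 (root_neq0 hPhi) // simple_root.
set c := 2 * B a b / B a a.
have c0 : 0 < c by rewrite /c divr_gt0 // mulr_gt0.
have e : srefl B a b = b - c *: a by rewrite sreflE.
have gP : srefl B a b \in Phi by rewrite (root_srefl hPhi) // simple_root.
have bR : b \in rem a D by rewrite mem_rem_uniq // !inE eq_sym ab.
have aR : a \in rem b D by rewrite mem_rem_uniq // !inE ab.
have [h1|h1] := root_pos_or_neg gP.
  apply: (@simple_ray b 1 (srefl B a b) (c *: a)) => //.
  - exact: posroot_cone.
  - by apply: coneZ; [exact: ltW | apply: cone_mem => //; apply: rem_uniq].
  - by rewrite dotZl mulr_gt0 // simple_gt0.
  - by rewrite scale1r e addrC subrK.
apply: (@simple_ray a c (- srefl B a b) b) => //.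
- exact: posroot_cone.
- by apply: cone_mem => //; apply: rem_uniq.
- exact: simple_gt0.
- by rewrite e opprB addrC subrK.
Qed.

(** A positive root other than a has a component off the ray of a, and s_a does
    not change that component. *)
Lemma srefl_simple_pos a b : a \in D -> posroot b -> b != a ->
  posroot (srefl B a b).
Proof.
move=> aD hb ba; have bP : b \in Phi by case/andP: hb.
have gP : srefl B a b \in Phi by rewrite (root_srefl hPhi) // simple_root.
have [//|h1] := root_pos_or_neg gP; exfalso.
have [t [y [t0 hy eb]]] := cone_split uD aD (posroot_cone hb).
set c := 2 * B a b / B a a.
apply: (@simple_ray a (c - t) (- srefl B a b) y) => //.
- exact: posroot_cone.
- apply: (cone_gt0 _ hy) => [x /mem_rem|]; first exact: simple_gt0.
  apply: contra_neqN ba => /eqP y0; rewrite eb y0 addr0.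
  have : t *: a \in Phi by rewrite -[_ *: a]addr0 -y0 -eb.
  move=> /(root_scale hPhi (simple_root aD)) [->|tN]; first by rewrite scale1r.
  by move: t0; rewrite tN oppr_ge0 ler10.
- rewrite sreflE -/c opprB addrCA scalerBl; congr (_ + _).
  by rewrite eb opprD addrCA subrr addr0.
Qed.

(** The positive and the negative terms of a linear relation have a common sum v
    with (v, v) <= 0 by obtuseness; then v = 0, and pairing with p shows that all
    coefficients vanish. *)
Lemma simple_free : free D.
Proof.
rewrite -[D]/(tval (in_tuple D)); apply/freeP => k.
rewrite /=; pose a (i : 'I_(size D)) := D`_i.
have -> : \sum_(i < size D) k i *: D`_i = \sum_i k i *: a i by [].
move=> e.
have aD i : a i \in D by apply: mem_nth.
pose u := \sum_(i | 0 < k i) k i *: a i.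
pose v := \sum_(i | ~~ (0 < k i)) (- k i) *: a i.
have uv : u = v.
  apply/eqP; rewrite -subr_eq0 /u /v -sumrN -[X in _ == X]e.
  rewrite [X in _ == X](bigID (fun i => 0 < k i)) /=.
  by apply/eqP; congr (_ + _); apply: eq_bigr => i _; rewrite scaleNr opprK.
have uu : B u u <= 0.
  rewrite {2}uv /u /v dot_suml sumr_le0 // => i ki; rewrite dot_sumr.
  rewrite sumr_le0 // => j kj; rewrite dotZl dotZr.
  rewrite pmulr_rle0 // mulr_ge0_le0 //; first by rewrite oppr_ge0 leNgt.
  apply: simple_obtuse => //; apply: contraNneq kj.
  move/eqP; rewrite nth_uniq // => /eqP/val_inj <- //.
have u0 : u = 0.
  by apply/eqP; rewrite -(dot_eq0 B) eq_le uu dot_ge0.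
have h i : 0 < k i -> False.
  move=> ki; have : 0 < B u p.
    rewrite /u (bigD1 i) //= dotDl dotZl ltr_wpDr //.
      rewrite dot_suml sumr_ge0 // => j /andP[kj _].
      by rewrite dotZl mulr_ge0 ?ltW // simple_gt0.
    by rewrite mulr_gt0 // simple_gt0.
  by rewrite u0 dot0l ltxx.
have h' i : k i < 0 -> False.
  move=> ki; have : 0 < B v p.
    have ki' : ~~ (0 < k i) by rewrite -leNgt ltW.
    rewrite /v (bigD1 i) //= dotDl dotZl ltr_wpDr //.
      rewrite dot_suml sumr_ge0 // => j /andP[kj _].
      rewrite dotZl mulr_ge0 //; first by rewrite oppr_ge0 leNgt.
      by rewrite ltW // simple_gt0.
    by rewrite mulr_gt0 ?oppr_gt0 // simple_gt0.
  by rewrite -uv u0 dot0l ltxx.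
by move=> i; case: (ltgtP (k i) 0) => // /[dup] ? => [/h'|/h].
Qed.

Lemma simple_span : <<Phi>>%VS = fullv -> <<D>>%VS = fullv.
Proof.
have h v : in_cone D v -> v \in <<D>>%VS.
  case=> c _ ->; rewrite big_seq; apply: memv_suml => d dD.
  by apply/memvZ/memv_span.
move=> hs; apply/eqP; rewrite eqEsubv subvf -hs; apply/span_subvP => a aP.
have [ap|ap] := root_pos_or_neg aP; first exact/h/posroot_cone.
by rewrite -memvN; apply/h/posroot_cone.
Qed.

Lemma simple_dot_gt0 b : posroot b -> exists2 a, a \in D & 0 < B a b.
Proof.
move=> hb; apply: boolp.contrapT => hn.
have : B b b <= 0.
  have [c c0 {1}->] := posroot_cone hb.
  rewrite dot_suml big_seq sumr_le0 // => a aD; rewrite dotZl mulr_ge0_le0 //.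
  by rewrite leNgt; apply/negP => h; apply: hn; exists a.
by rewrite leNgt dot_gt0 (root_neq0 hPhi) //; case/andP: hb.
Qed.

Lemma srefl_conj a b v : a \in Phi ->
  srefl B (srefl B a b) v = srefl B a (srefl B b (srefl B a v)).
Proof.
move=> /(root_neq0 hPhi) a0.
rewrite [srefl B b _]sreflE linearB linearZ /= (sreflK B a0) sreflE.
by rewrite (srefl_isom B _ _ a0) dot_srefl.
Qed.

(** Induction on the height (b, p): a positive root that is not simple has a
    positive product with some simple root, whose reflection lowers it. *)
Lemma posroot_ind (P : V -> Prop) : {in D, forall d, P d} ->
  (forall a g, a \in D -> posroot g -> P g -> P (srefl B a g)) ->
  forall b, posroot b -> P b.
Proof.
move=> Pd Ps b; have [n] := ubnP (count (fun a => B a p < B b p) Phi).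
elim: n b => [//|n ih] b; rewrite ltnS => hn hb.
have [bD|bD] := boolP (b \in D); first exact: Pd.
have [a aD ab] := simple_dot_gt0 hb.
have ba : b != a by apply: contraNneq bD => ->.
have hg := srefl_simple_pos aD hb ba; set g := srefl B a b in hg.
have aP := simple_root aD.
have gb : B g p < B b p.
  rewrite /g sreflE dotDl dotNl dotZl gtrDl oppr_lt0 mulr_gt0 ?simple_gt0 //.
  by rewrite divr_gt0 ?mulr_gt0 // dot_gt0 (root_neq0 hPhi).
rewrite -(sreflK B (root_neq0 hPhi aP) b); apply: Ps => //; apply: ih => //.
apply: leq_trans hn; apply: (sub_count_lt (x := g)) => //.
- by move=> x /= /lt_trans; apply.
- by case/andP: hg.
- by rewrite /= ltxx.
Qed.

Lemma srefl_pos_word b : posroot b ->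
  exists2 ss, {subset ss <= D} & srefl B b = word B ss.
Proof.
apply: (@posroot_ind (fun b => exists2 ss, {subset ss <= D} & srefl B b = word B ss)).
  move=> d dD; exists [:: d]; first by move=> x; rewrite inE => /eqP ->.
  by apply/lfunP => v; rewrite word_cons /= id_lfunE.
move=> a g aD _ [ss ssD e]; exists (a :: ss ++ [:: a]).
  move=> x; rewrite inE mem_cat inE => /or3P[/eqP->|/ssD|/eqP->] //.
apply/lfunP => v; rewrite word_cons word_cat word_cons [word B [::] _]id_lfunE.
by rewrite -e srefl_conj // simple_root.
Qed.

Lemma groupW_simple_word w : w \in W ->
  exists2 ss, {subset ss <= D} & w = word B ss.
Proof.
case/(groupW_word hW hPhi) => ss + ->; elim: ss => [|a ss ih] h.
  by exists [::].
have aP : a \in Phi by apply: h; rewrite mem_head.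
have [|ts tsD ets] := ih; first by move=> x xs; apply: h; rewrite inE xs orbT.
have [us usD eus] : exists2 us, {subset us <= D} & srefl B a = word B us.
  have [/srefl_pos_word //|/srefl_pos_word [us usD eus]] := root_pos_or_neg aP.
  by exists us => //; rewrite -eus sreflN.
exists (us ++ ts); first by move=> x; rewrite mem_cat => /orP[/usD|/tsD].
by apply/lfunP => v; rewrite word_cat word_cons ets eus.
Qed.

Definition inversions (w : 'End(V)) : {fset V} :=
  [fset a in Phi | (0 < B a p) && (B a (w p) < 0)]%fset.

Lemma in_inversions w a :
  (a \in inversions w) = [&& a \in Phi, 0 < B a p & B a (w p) < 0].
Proof. by rewrite !inE. Qed.

(** Follow the root a along the word: at the letter where it becomes negative it
    equals the root of that letter, so s_a cancels this letter. *)
Lemma strong_exchange ss a : {subset ss <= D} -> posroot a ->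
  B a (word B ss p) < 0 ->
  exists ts, [/\ {subset ts <= D}, (size ts).+1 = size ss &
                 (srefl B a \o word B ss)%VF = word B ts].
Proof.
elim: ss a => [|b ss ih] a hss ha.
  by rewrite /= id_lfunE; case/andP: ha => _ /ltW; rewrite leNgt => /negP.
have bD : b \in D by apply: hss; rewrite mem_head.
have hss' : {subset ss <= D} by move=> x xs; apply: hss; rewrite inE xs orbT.
have b0 := root_neq0 hPhi (simple_root bD).
rewrite word_cons -dot_srefl; have [->|ab] := eqVneq a b => h.
  exists ss; split=> //; apply/lfunP => v.
  by rewrite comp_lfunE word_cons (sreflK B b0).
have [ts [tsD sz e]] := ih _ hss' (srefl_simple_pos bD ha ab) h.
exists (b :: ts); split=> [x||].
- by rewrite inE => /predU1P[->|/tsD].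
- by rewrite /= sz.
apply/lfunP => v; rewrite comp_lfunE !word_cons -e comp_lfunE.
by rewrite (srefl_conj _ _ (simple_root bD)) !(sreflK B b0).
Qed.

Lemma inversions_srefl_lt a w : a \in D -> w \in W -> 0 < B a (w p) ->
  (#|` inversions w| < #|` inversions (srefl B a \o w)|)%N.
Proof.
move=> aD wW h; have aP := simple_root aD; have a0 := root_neq0 hPhi aP.
have hN : a \notin (srefl B a @` inversions w)%fset.
  apply/imfsetP => -[b /=]; rewrite in_inversions => /and3P[_ b0 _] e.
  move: b0; rewrite -(sreflK B a0 b) -e srefl_id // dotNl oppr_gt0.
  by move/lt_trans/(_ (simple_gt0 aD)); rewrite ltxx.
have <- : #|` srefl B a @` inversions w|%fset = #|` inversions w|.
  by rewrite card_imfset //=; apply: (can_inj (sreflK B a0)).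
rewrite -add1n -[X in (X + _)%N](_ :
    (a \notin (srefl B a @` inversions w)%fset) = 1%N :> nat).
  rewrite -cardfsU1; apply/fsubset_leq_card/fsubsetP => x.
  rewrite in_inversions inE => /orP[/fset1P -> |/imfsetP[b /=]].
    by rewrite aP simple_gt0 //= comp_lfunE -dot_srefl srefl_id // dotNl oppr_lt0.
  rewrite in_inversions => /and3P[bP b0 bw] ->.
  have /andP[-> ->] : posroot (srefl B a b).
    apply: srefl_simple_pos; rewrite // /posroot ?bP //.
    by apply: contraTneq bw => ->; rewrite -leNgt ltW.
  by rewrite comp_lfunE srefl_isom.
by rewrite hN.
Qed.

Lemma inversions_srefl_le a w : a \in D ->
  (#|` inversions w| <= #|` inversions (srefl B a \o w)|.+1)%N.
Proof.
move=> aD; have aP := simple_root aD; have a0 := root_neq0 hPhi aP.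
set I := inversions (_ \o w).
have h : (inversions w `<=` a |` (srefl B a @` I))%fset.
  apply/fsubsetP => b; rewrite in_inversions !inE => /and3P[bP b0 bw].
  have [//|ba] := eqVneq b a; apply/imfsetP; exists (srefl B a b) => /=.
    rewrite in_inversions comp_lfunE srefl_isom // bw andbT.
    by apply: (srefl_simple_pos aD) => //; rewrite /posroot bP.
  by rewrite (sreflK B a0).
apply: (leq_trans (fsubset_leq_card h)).
rewrite cardfsU1 -add1n leq_add ?leq_b1 // card_imfset //=.
exact: (can_inj (sreflK B a0)).
Qed.

Lemma root_regW w a : w \in W -> a \in Phi -> B a (w p) != 0.
Proof.
move=> wW aP; have [w' w'W [_ wK]] := groupW_inv hW wW.
by rewrite -[a]wK (groupW_isom hW hPhi) // hp // (rootW hPhi).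
Qed.

(** Build the word one letter at a time: a new letter either creates an inversion
    or, by the exchange property, can be absorbed by deleting another one. *)
Lemma reduced_word w : w \in W -> exists ss, [/\ {subset ss <= D}, w = word B ss &
  (size ss <= #|` inversions w|)%N].
Proof.
case/groupW_simple_word => ss + ->; elim: ss => [|a ss ih] h.
  by exists [::].
have aD : a \in D by apply: h; rewrite mem_head.
have [|ts [tsD ets sz]] := ih; first by move=> x xs; apply: h; rewrite inE xs orbT.
have uW : word B ss \in W.
  rewrite ets; apply: (word_inW hW hPhi) => x /tsD; exact: simple_root.
have := root_regW uW (simple_root aD).
rewrite /= neq_lt => /orP[hlt|hgt].
  rewrite ets in hlt; have [us [usD szu eus]] := strong_exchange tsD (simple_pos aD) hlt.
  exists us; split=> //; first by rewrite ets.
  by rewrite -ltnS szu (leq_trans sz) // inversions_srefl_le.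
exists (a :: ts); split; last first.
- by rewrite /= (leq_ltn_trans sz) // inversions_srefl_lt.
- by rewrite /= ets.
by move=> x; rewrite inE => /predU1P[->|/tsD].
Qed.

End SimpleSystem.

Section Rank.
Variables (R : rcfType) (V : vectType R) (B : {dot V for idfun}).

Definition moved (w : 'End(V)) : {vspace V} := limg (\1%VF - w).

Lemma movedP (w : 'End(V)) u : reflect (exists v, u = v - w v) (u \in moved w).
Proof.
apply: (iffP memv_imgP) => [[v _ ->]|[v ->]]; exists v; rewrite ?memvf //;
  by rewrite add_lfunE opp_lfunE id_lfunE.
Qed.

(** Each reflection moves only a line. *)
Lemma rank_word (ss : seq V) : (\dim (moved (word B ss)) <= size ss)%N.
Proof.
elim: ss => [|a ss ih].
  rewrite leqn0 dimv_eq0 -subv0; apply/subvP => _ /movedP[v ->].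
  by rewrite /= id_lfunE subrr mem0v.
apply: leq_trans (_ : (\dim (<[a]> + moved (word B ss))%VS <= _)%N).
  apply/dimvS/subvP => _ /movedP[v ->].
  rewrite word_cons sreflE opprB addrCA.
  apply: memv_add; first exact/memvZ/memv_line.
  by apply/movedP; exists v.
rewrite (leq_trans (dimv_add_leqif _ _)) //= -add1n leq_add //.
by rewrite dim_vline leq_b1.
Qed.

Variables (W : {fset 'End(V)}) (Phi : {fset V}).
Hypotheses (hW : finite_reflection_group B W) (hPhi : root_system_of B W Phi).
Variable p : V.
Hypothesis hp : forall a, a \in Phi -> B a p != 0.

Lemma rank_le_inversions w : w \in W ->
  (\dim (moved w) <= #|` inversions B Phi p w|)%N.
Proof.
move=> wW; have [D hD] := simple_system_ex B Phi p.
have [ss [_ -> sz]] := reduced_word hW hPhi hp hD wW.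
exact: leq_trans (rank_word _) sz.
Qed.

(** The element has no inversion for p, so it is the empty word. *)
Lemma regular_stab w : w \in W -> w p = p -> w = \1%VF.
Proof.
move=> wW e; have := rank_le_inversions wW.
have -> : inversions B Phi p w = fset0.
  apply/fsetP => a; rewrite in_inversions e inE; apply/negP => /and3P[_].
  by move=> /lt_trans /[apply]; rewrite ltxx.
rewrite cardfs0 leqn0 dimv_eq0 => /eqP h; apply/lfunP => v; apply/eqP.
by rewrite eq_sym -subr_eq0 -memv0 -h id_lfunE; apply/movedP; exists v.
Qed.
End Rank.

(** * The root of unity of least argument *)

Section PrincipalRoot.
Variable (R : rcfType).
Implicit Types (l mu z : R[i]) (b : nat).

Lemma unity_root_Re_Im b mu : (0 < b)%N -> mu ^+ b = 1 ->
  (Re mu) ^+ 2 + (Im mu) ^+ 2 = 1.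
Proof.
move=> b0 e; have : `|mu| ^+ b = 1 by rewrite -normrX e normr1.
move/eqP; rewrite pexpr_eq1 // => /eqP n1.
by apply: complexI; rewrite add_Re2_Im2 n1 expr1n.
Qed.

Lemma unity_root_conj b mu : (0 < b)%N -> mu ^+ b = 1 -> mu * (conjc mu) = 1.
Proof.
move=> b0 /(unity_root_Re_Im b0); case: mu => c d /= h.
apply/eqP; rewrite eq_complex /=; apply/andP; split; apply/eqP; last by ring.
by rewrite -h; ring.
Qed.

Lemma unit_Re_eq1 mu : (Re mu) ^+ 2 + (Im mu) ^+ 2 = 1 -> Re mu = 1 -> mu = 1.
Proof.
case: mu => c d /= h c1; move: h; rewrite c1 expr1n -[RHS]addr0.
by move/addrI/eqP; rewrite sqrf_eq0 => /eqP ->.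
Qed.

(** For unit vectors (a, s) and (c, d) at angles t <= u in [0, pi], this says
    that sin (u - t) >= 0. *)
Lemma arc_det (a s c d : R) : a ^+ 2 + s ^+ 2 = 1 -> c ^+ 2 + d ^+ 2 = 1 ->
  0 <= s -> 0 <= d -> c <= a -> s * c <= d * a.
Proof.
move=> h1 h2 s0 d0 ca; have [a0|a0] := lerP 0 a.
  have [c0|c0] := lerP c 0.
    by apply: (@le_trans _ _ 0); [exact: mulr_ge0_le0 | exact: mulr_ge0].
  have sd : s <= d.
    by rewrite -(ler_pXn2r (n := 2)) ?nnegrE //; nra.
  by nra.
have ds : d <= s.
  by rewrite -(ler_pXn2r (n := 2)) ?nnegrE //; nra.
nra.
Qed.

(** A rotation by at least the argument of l, and at most a half-turn, takes a
    point z with Im z > 0 > Im (l z) to or below the real axis. Here l = a + i s,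
    the rotation is c + i d, and z = p + i q. *)
Lemma sector_det (a s c d p q : R) : a ^+ 2 + s ^+ 2 = 1 -> c ^+ 2 + d ^+ 2 = 1 ->
  0 <= s -> 0 <= d -> c <= a -> c != 1 ->
  0 < q -> a * q + s * p < 0 -> 0 < c * q + d * p -> False.
Proof.
move=> h1 h2 s0 d0 ca c1 q0 hl hm.
have h := arc_det h1 h2 s0 d0 ca.
have [d1|d1] := eqVneq d 0.
  move: h2; rewrite d1 expr0n addr0 => /eqP; rewrite sqrf_eq1 (negbTE c1) /=.
  by move/eqP => c2; move: hm; rewrite d1 c2; nra.
have d2 : 0 < d by rewrite lt_neqAle eq_sym d1.
have h3 : d * (a * q + s * p) < 0 by rewrite pmulr_rlt0.
have h4 : 0 <= s * (c * q + d * p) by rewrite mulr_ge0 // ltW.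
nra.
Qed.

(** This is exp (2 i pi / b), singled out by its real part instead of its
    argument. *)
Definition principal b l := [/\ b.-primitive_root l, 0 <= Im l &
  forall mu, mu ^+ b = 1 -> mu != 1 -> Re mu <= Re l].

(** The sector Im z > 0 > Im (l z) has the angle of l, so its rotates by the b-th
    roots of unity are disjoint. *)
Lemma principal_sector b l z mu : (0 < b)%N -> principal b l -> mu ^+ b = 1 ->
  0 < Im z -> Im (l * z) < 0 -> 0 < Im (mu * z) -> Im (l * (mu * z)) < 0 ->
  mu = 1.
Proof.
move=> b0 [lp l0 lmax].
wlog : mu z / 0 <= Im mu => [hw mb z0 lz0 mz0 lmz0|].
  have [m0|m0] := lerP 0 (Im mu); first exact: (hw mu z).
  have mc := unity_root_conj b0 mb.
  suff : conjc mu = 1 by move=> e; rewrite e mulr1 in mc.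
  apply: (hw _ (mu * z)) => //.
  - by case: (mu) m0 => c d /=; rewrite oppr_ge0 => /ltW.
  - by rewrite -rmorphXn /= mb rmorph1.
  - by rewrite mulrA [(conjc mu) * _]mulrC mc mul1r.
  - by rewrite [(conjc mu) * _]mulrA [(conjc mu) * _]mulrC mc mul1r.
move=> m0 mb z0 lz0 mz0 lmz0; apply/eqP; apply/negPn/negP => m1.
have hl := unity_root_Re_Im b0 (prim_expr_order lp).
have hm := unity_root_Re_Im b0 mb; have hr := lmax _ mb m1.
have m1' : Re mu != 1 by apply: contraNneq m1 => /(unit_Re_eq1 hm) ->.
apply: (@sector_det (Re l) (Im l) (Re mu) (Im mu) (Re z) (Im z)) => //.
- by move: lz0; case: (l) => ? ?; case: (z) => ? ?; simpc.
- by move: mz0; case: (mu) => ? ?; case: (z) => ? ?; simpc.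
Qed.

(** The candidate l is the b-th root of unity other than 1 with the largest real
    part, in the upper half plane. It is primitive because its powers exhaust the
    b-th roots of unity: in a coset of the group of powers, an element other than
    1 with the largest real part would come closer to 1 by a rotation by l or its
    inverse. *)
Lemma principal_ex b mu : b.-primitive_root mu -> exists l, principal b l.
Proof.
move=> mup; have b0 := prim_order_gt0 mup.
have [b1|b1] := leqP b 1.
  have {b0 b1} b1 : b = 1%N by apply/eqP; rewrite eqn_leq b1.
  exists mu; have e1 := prim_expr_order mup; rewrite b1 expr1 in e1.
  by split=> [//||m]; rewrite ?e1 // b1 expr1 => ->; rewrite eqxx.
have munit k : (mu ^+ k) ^+ b = 1.
  by rewrite exprAC (prim_expr_order mup) expr1n.
have mN1 (k : 'I_b) : (k != 0%N :> nat) -> mu ^+ k != 1.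
  move=> k0; rewrite -(prim_order_dvd mup); apply: contra k0 => /dvdn_leq.
  by case: (k) => -[//|m] /= hm /(_ isT); rewrite leqNgt hm.
pose k1 := Ordinal b1.
case: (@arg_maxP _ _ _ k1 (fun k : 'I_b => k != 0%N :> nat)
        (fun k => Re (mu ^+ k)) isT) => k k0 kmax.
have hmax m : m ^+ b = 1 -> m != 1 -> Re m <= Re (mu ^+ k).
  move/(prim_rootP mup) => [j ->] j1; apply: kmax.
  by apply: contraNneq j1 => /= ->; rewrite expr0.
have [l [lb l1 l0 lmax]] : exists l, [/\ l ^+ b = 1, l != 1, 0 <= Im l &
    forall m, m ^+ b = 1 -> m != 1 -> Re m <= Re l].
  have [m0|m0] := lerP 0 (Im (mu ^+ k)).
    by exists (mu ^+ k); split=> //; exact: mN1.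
  exists (conjc (mu ^+ k)); split.
  - by rewrite -rmorphXn /= munit rmorph1.
  - by rewrite -(rmorph1 conjc) (inj_eq (can_inj (@conjcK R))) mN1.
  - by move: m0; case: (mu ^+ k) => ? ? /=; rewrite oppr_ge0 => /ltW.
  - by move=> m mb m1; case: (mu ^+ k) (hmax m mb m1).
exists l; split=> //.
have hl := unity_root_Re_Im b0 lb.
have lc := unity_root_conj b0 lb.
have lgen m : m ^+ b = 1 -> exists j, m = l ^+ j.
  move=> mb.
  case: (@arg_maxP _ _ _ k1 xpredT (fun j : 'I_b => Re (m * l ^+ j)) isT) => j _ jmax.
  have {}jmax i : Re (m * l ^+ i) <= Re (m * l ^+ j).
    by rewrite -(expr_mod i lb); apply: (jmax (Ordinal (ltn_pmod i b0))).
  have nub : (m * l ^+ j) ^+ b = 1 by rewrite exprMn mb exprAC lb expr1n mulr1.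
  have [e|nu1] := eqVneq (m * l ^+ j) 1.
    exists (b - j)%N; rewrite -[m]mulr1 -lb -{1}(subnKC (ltnW (ltn_ord j))).
    by rewrite exprD mulrA e mul1r.
  exfalso; have hr := lmax _ nub nu1; have hn := unity_root_Re_Im b0 nub.
  have l1' : Re l != 1 by apply: contraNneq l1 => /(unit_Re_eq1 hl) ->.
  have h1 := jmax (j + 1)%N; have h2 := jmax (j + b.-1)%N.
  have lV : l ^+ b.-1 = conjc l.
    by apply: (mulfI (_ : l != 0)); [apply: contra_eq_neq lb => ->;
      rewrite expr0n gtn_eqF // eq_sym oner_eq0 | rewrite -exprS prednK // lb lc].
  rewrite exprD expr1 mulrA in h1; rewrite exprD mulrA lV in h2.
  move: (m * l ^+ j) hr hn h1 h2 => [c d]; move: (l) hl l0 l1' => [a s] /=.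
  simpc => /= hl l0 l1' hr hn h1 h2.
  have a1 : a < 1 by rewrite lt_neqAle l1'; nra.
  have key d' : 0 <= d' -> c ^+ 2 + d' ^+ 2 = 1 -> c * a + d' * s <= c -> False.
    move=> d0 hd' hle; have h := arc_det hl hd' l0 d0 hr.
    have hd : 0 <= d' * s by exact: mulr_ge0.
    have a1' : 0 < 1 - a by rewrite subr_gt0.
    case: (ltgtP c 0) => c0.
    - by have : c * (1 - a) < 0 by [rewrite nmulr_rlt0]; nra.
    - have sd : s <= d' by rewrite -(ler_pXn2r (n := 2)) ?nnegrE //; nra.
      have h1' : s * s <= d' * s by rewrite ler_wpM2r.
      have : 0 < (1 - a) * (1 + a - c) by apply: mulr_gt0 => //; lra.
      nra.
    have s1 : 0 < s * s by rewrite c0 in hr; nra.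
    have d1 : d' * d' = 1 by rewrite c0 in hd'; nra.
    have s2 : s != 0 by apply: contraTneq s1 => ->; rewrite mulr0 ltxx.
    have d2 : d' != 0 by apply: contra_eq_neq d1 => ->; rewrite mulr0 eq_sym oner_eq0.
    have : 0 < d' * s by rewrite lt_neqAle hd eq_sym mulf_neq0.
    by rewrite c0 in hle; nra.
  have [d0|d0] := lerP 0 d; first by apply: (key d) => //; nra.
  by apply: (key (- d)); nra.
have [m mdiv lm] := prim_order_exists b0 lb.
have [j ej] := lgen _ (prim_expr_order mup).
suff -> : b = m by [].
apply/eqP; rewrite eqn_dvd lm andbT (prim_order_dvd mup) ej exprAC.
by rewrite (prim_expr_order mdiv) expr1n.
Qed.

End PrincipalRoot.

(** * Roots at complex points *)

Section Complexification.
Variables (R : rcfType) (V : vectType R) (B : {dot V for idfun}).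
Implicit Types (x : complexification V) (w : 'End(V)) (a : V).

Definition cval a x : R[i] := cform B (cembed a) x.

Lemma cvalE a x : cval a x = B a x.1 +i* B a x.2.
Proof. by rewrite /cval /cform /= !dot0l subr0 addr0. Qed.

Lemma cvalZ a c x : cval a (c *: x) = c * cval a x.
Proof.
rewrite !cvalE; case: c => c d; simpc.
by rewrite dotDr dotNr !dotZr dotDr !dotZr addrC [X in _ +i* X]addrC.
Qed.

Lemma cvalD a x y : cval a (x + y) = cval a x + cval a y.
Proof. by rewrite !cvalE; simpc; rewrite !dotDr. Qed.

Lemma cvalN a x : cval (- a) x = - cval a x.
Proof. by rewrite !cvalE; simpc; rewrite !dotNl. Qed.

Lemma cval_eq0 a x : (cval a x == 0) = (B a x.1 == 0) && (B a x.2 == 0).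
Proof. by rewrite cvalE eq_complex. Qed.

Lemma cextendZ w c x : cextend w (c *: x) = c *: cextend w x.
Proof.
case: c => c d; rewrite /cextend; congr pair => /=;
  by rewrite ?(linearB, linearD, linearZ).
Qed.

Lemma cextendM w w' x : cextend (w \o w')%VF x = cextend w (cextend w' x).
Proof. by rewrite /cextend !comp_lfunE. Qed.

Lemma cextend1 x : cextend \1%VF x = x.
Proof. by case: x => u v; rewrite /cextend !id_lfunE. Qed.

Lemma pow_eigen w l x k : cextend w x = l *: x -> cextend (pow w k) x = l ^+ k *: x.
Proof.
move=> e; elim: k => [|k ih]; first by rewrite cextend1 expr0 scale1r.
by rewrite [pow w k.+1]/= cextendM ih cextendZ e scalerA exprSr.
Qed.

Variables (W : {fset 'End(V)}) (Phi : {fset V}).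
Hypotheses (hW : finite_reflection_group B W) (hPhi : root_system_of B W Phi).

Lemma cvalW w a x : w \in W -> cval (w a) (cextend w x) = cval a x.
Proof. by move=> wW; rewrite !cvalE !(groupW_isom hW hPhi). Qed.

Lemma cval_pow w l x k a : w \in W -> cextend w x = l *: x ->
  l ^+ k * cval (pow w k a) x = cval a x.
Proof.
move=> wW e; rewrite -cvalZ -(pow_eigen _ e) cvalW //.
exact: (pow_inW hW).
Qed.

Lemma in_support x a :
  (a \in [fset a in Phi | cform B (cembed a) x != 0]%fset) =
  (a \in Phi) && (cval a x != 0).
Proof. by rewrite !inE. Qed.

(** The translates of the roots in T by powers of w are roots whose values at x
    differ from those in T by powers of l, so they do not vanish at x either. *)
Lemma orbit_count w l x b (T : seq V) : w \in W -> cextend w x = l *: x ->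
  uniq T -> {in T, forall a, (a \in Phi) && (cval a x != 0)} ->
  (forall a a' j j', a \in T -> a' \in T -> (j < b)%N -> (j' < b)%N ->
     pow w j a = pow w j' a' -> a = a' /\ j = j') ->
  (b * size T <= root_count B Phi x)%N.
Proof.
move=> wW e uT TX inj.
set S := [seq pow w j a | a <- T, j <- iota 0 b].
have uS : uniq S.
  apply: allpairs_uniq => //; first exact: iota_uniq.
  move=> [a j] [a' j'] /allpairsP[[c k] /= [cT kb [-> ->]]].
  move=> /allpairsP[[c' k'] /= [c'T k'b [-> ->]]] /=.
  move: kb k'b; rewrite !mem_iota !add0n /= => kb k'b.
  by case/inj => // -> ->.
rewrite mulnC -[X in (_ * X)%N](size_iota 0) -(size_allpairs (fun a j => pow w j a)).
rewrite /root_count; apply: uniq_leq_size => // y.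
case/allpairsP => -[a j] /= [aT _ ->]; rewrite in_support.
have /andP[aP az] := TX _ aT; rewrite (rootW hPhi) // ?(pow_inW hW) //=.
by apply: contraNneq az => z; rewrite -(cval_pow j a wW e) z mulr0.
Qed.

End Complexification.

Section Generic.
Variables (R : rcfType) (V : vectType R) (B : {dot V for idfun}).

Lemma upper_bound (s : seq R) : exists2 M : R, 0 < M & {in s, forall t, t < M}.
Proof.
elim: s => [|t s [M M0 hM]]; first by exists 1.
exists (M + `|t|); first by rewrite ltr_pwDl.
move=> u; rewrite inE => /predU1P[->|/hM h].
  by rewrite (le_lt_trans (ler_norm t)) // ltrDr.
by rewrite (lt_le_trans h) // lerDl.
Qed.

(** A vector good for the first roots is corrected by a multiple t k, where t
    avoids finitely many values; an upper bound of these values will do. *)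
Lemma generic_vector (K : {vspace V}) (s : seq V) :
  {in s, forall a, exists2 k, k \in K & B a k != 0} ->
  exists2 q, q \in K & {in s, forall a, B a q != 0}.
Proof.
elim: s => [|a s ih] h; first by exists 0; rewrite ?mem0v.
have [b bs|q qK hq] := ih; first by apply: h; rewrite inE bs orbT.
have [k kK hk] := h a (mem_head _ _).
have [t _ ht] := upper_bound [seq - B b q / B b k | b <- a :: s].
exists (q + t *: k); first by rewrite memvD // memvZ.
move=> b bs; rewrite dotDr dotZr.
have [bk|bk] := eqVneq (B b k) 0.
  rewrite bk mulr0 addr0; move: bs; rewrite inE => /predU1P[eb|/hq //].
  by rewrite -eb bk eqxx in hk.
rewrite addrC -[B b q]opprK subr_eq0.
apply: contraTneq (ht (- B b q / B b k) (map_f _ bs)) => <-.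
by rewrite mulfK // ltxx.
Qed.

End Generic.

Section Inequality.
Variables (R : rcfType) (V : vectType R) (B : {dot V for idfun}).
Variables (W : {fset 'End(V)}) (Phi : {fset V}).
Hypotheses (hW : finite_reflection_group B W) (hPhi : root_system_of B W Phi).

Lemma moved_orth w u v : w \in W -> u \in moved w -> w v = v -> B u v = 0.
Proof.
move=> wW /movedP[t ->] e; rewrite dotDl dotNl -{2}e (groupW_isom hW hPhi) //.
exact: subrr.
Qed.

Lemma mem_fix (w : 'End(V)) v : (v \in fixedSpace w) = (w v == v).
Proof. exact/fixedSpaceP/eqP. Qed.

Lemma dim_fixed_moved (w : 'End(V)) : (\dim (fixedSpace w) + \dim (moved w))%N = \dim {:V}.
Proof.
have -> : fixedSpace w = lker (\1%VF - w).
  apply/vspaceP => v; rewrite mem_fix memv_ker add_lfunE opp_lfunE id_lfunE.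
  by rewrite subr_eq0 eq_sym.
by rewrite -(limg_ker_dim (\1%VF - w) fullv) capfv.
Qed.

(** The moved space is contained in the orthogonal complement of the fixed space,
    and their dimensions agree. *)
Lemma not_moved w a : w \in W -> a \notin moved w ->
  exists2 k, w k = k & B a k != 0.
Proof.
move=> wW aU; apply: boolp.contrapT => hn.
have hk k : w k = k -> B a k = 0.
  by move=> e; apply/eqP/negPn/negP => h; apply: hn; exists k.
pose K := fixedSpace w.
have : ((moved w + <[a]>) :&: K = 0)%VS.
  apply/eqP; rewrite -subv0; apply/subvP => u; rewrite memv_cap memv0 => /andP[].
  case/memv_addP => m mU [_ /vlineP[c ->] ->]; rewrite mem_fix => /eqP e.
  rewrite -(dot_eq0 B) dotDl (moved_orth wW mU e) dotZl hk // mulr0 addr0.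
  exact: eqxx.
move/dimv_disjoint_sum => e1.
have : (\dim (moved w + <[a]> + K)%VS <= \dim {:V})%N.
  by rewrite dimvS // subvf.
rewrite e1 -(dim_fixed_moved w) addnC leq_add2l.
rewrite leqNgt => /negP; apply.
by rewrite dim_add_line.
Qed.

Hypothesis hirr : irreducible_roots B Phi.
Hypothesis hspan : <<Phi>>%VS = fullv.

Lemma orth_roots0 v : {in Phi, forall a, B a v = 0} -> v = 0.
Proof.
move=> h; apply/eqP; rewrite -(dot_eq0 B); apply/eqP.
suff hu u : B u v = 0 by [].
have : u \in <<Phi>>%VS by rewrite hspan memvf.
move/(@coord_span _ _ _ (in_tuple Phi)) => ->.
rewrite dot_suml big1 // => i _; rewrite dotZl h ?mulr0 //.
exact: mem_nth.
Qed.

Definition support (x : complexification V) : seq V :=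
  [seq a <- Phi | cval B a x != 0].

(** Let U be the span of the roots not vanishing at x. A root a2 outside U is
    orthogonal to each root a not vanishing at x, since otherwise s_a2 a would be
    another such root and a2 a combination of the two. Thus the roots in U and the
    roots outside U would decompose the root system. *)
Lemma support_span x : x != 0 -> (fullv <= <<support x>>)%VS.
Proof.
move=> x0; set X := support x; set U := <<X>>%VS.
pose P1 := [fset a in Phi | a \in U]%fset; pose P2 := [fset a in Phi | a \notin U]%fset.
have XU a : a \in Phi -> cval B a x != 0 -> a \in U.
  by move=> aP az; apply: memv_span; rewrite mem_filter az.
suff h2 : P2 = fset0.
  rewrite -hspan; apply/span_subvP => a aP; apply/negPn/negP => aU.
  by have : a \in P2 by [rewrite !inE /= aP]; rewrite h2 inE.
apply/eqP/negPn/negP => P2n; case: hirr => _; apply; exists P1, P2; split=> //.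
- apply/negP => /eqP P10; case/negP: x0; apply/eqP.
  have h a : a \in Phi -> cval B a x = 0.
    move=> aP; apply/eqP/negPn/negP => az.
    by have : a \in P1 by [rewrite !inE /= aP XU]; rewrite P10 inE.
  case: x h {XU X U P1 P2 P2n P10} => u v h.
  by congr pair; apply: orth_roots0 => a /h/eqP; rewrite cval_eq0 => /andP[/eqP? /eqP?].
- by apply/fsetP => a; rewrite !inE /=; case: (a \in U); rewrite ?andbT ?andbF ?orbF.
move=> a1 a2; rewrite !inE /= => /andP[_ a1U] /andP[a2P a2U].
have a2z : cval B a2 x = 0.
  by apply/eqP/negPn/negP => az; case/negP: a2U; apply: XU.
have h a : a \in X -> B a a2 = 0.
  rewrite mem_filter => /andP[az aP]; apply/eqP/negPn/negP => aa2.
  have aU : a \in U by apply: XU.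
  case/negP: a2U; set c := 2 * B a2 a / B a2 a2.
  have c0 : c != 0.
    by rewrite !mulf_eq0 !negb_or pnatr_eq0 invr_eq0 dot_eq0 (root_neq0 hPhi) // dotC aa2.
  have e : srefl B a2 a = a - c *: a2 by rewrite sreflE.
  have : srefl B a2 a \in U.
    apply: XU; first exact: (root_srefl hPhi).
    rewrite e; suff -> : cval B (a - c *: a2) x = cval B a x by [].
    have : cval B a2 x == 0 by rewrite a2z.
    rewrite cval_eq0 => /andP[/eqP e1 /eqP e2].
    by rewrite !cvalE !dotDl !dotNl !dotZl e1 e2 mulr0 !subr0.
  rewrite e => h; have : c *: a2 \in U.
    by rewrite -[c *: a2](subKr a) memvB.
  by move/(memvZ c^-1); rewrite scalerA mulVf // scale1r.
move: a1U => /(@coord_span _ _ _ (in_tuple X)) ->.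
by rewrite dot_suml big1 // => i _; rewrite dotZl h ?mulr0 // mem_nth.
Qed.

End Inequality.

(** * The lower bound on the number of nonvanishing roots *)

Section Complement.
Variables (K : numFieldType) (V : vectType K).

(** The last condition makes the chosen vectors and their opposites distinct
    modulo U; it separates the orbits of these vectors under any map that acts
    trivially modulo U. *)
Lemma complement_family (X : seq V) (U : {vspace V}) : (fullv <= <<X>>)%VS ->
  exists E : seq V, [/\ uniq E, {subset E <= X},
    (\dim U + size E)%N = \dim {:V}, {in E, forall e, e \notin U} &
    {in E &, forall e e', (e - e' \in U -> e = e') /\ e + e' \notin U}].
Proof.
move=> hX; have : (\dim U <= \dim {:V})%N by rewrite dimvS ?subvf.
move/subnKC; move: (_ - _)%N => k; elim: k U => [|k ih] U hk.
  by exists [::]; split=> //; rewrite addn0 -[RHS]hk addn0.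
have [a aX aU] : exists2 a, a \in X & a \notin U.
  apply/hasP; apply: contra_eqT hk => /hasPn h.
  have : (\dim {:V} <= \dim U)%N.
    by rewrite dimvS // (subv_trans hX) //; apply/span_subvP => a /h; rewrite negbK.
  by move=> h1; rewrite gtn_eqF // (leq_ltn_trans h1) // addnS ltnS leq_addr.
have [|E [uE EX hE EU hEE]] := ih (U + <[a]>)%VS.
  by rewrite -hk dim_add_line // addSnnS.
have UU' : (U <= U + <[a]>)%VS by apply: addvSl.
have aU' : a \in (U + <[a]>)%VS by apply: subvP (addvSr _ _) _ (memv_line _).
exists (a :: E); split.
- by rewrite /= uE andbT; apply: contraL aU' => /EU.
- by move=> e; rewrite inE => /predU1P[->|/EX].
- by move: hE; rewrite dim_add_line //= addSn addnS.
- move=> e; rewrite inE => /predU1P[-> //|/EU].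
  by apply: contra; apply: (subvP UU').
move=> e e'; rewrite !inE => /predU1P[->|eE] /predU1P[->|e'E].
- split=> //; apply: contra aU => h.
  have -> : a = 2^-1 *: (a + a).
    by rewrite -mulr2n -scaler_nat scalerA mulVf ?scale1r // pnatr_eq0.
  exact: memvZ.
- split; last first.
    apply: contra (EU _ e'E) => /(subvP UU') h.
    by rewrite -[e'](addKr a) memvD // memvN.
  move=> /(subvP UU') h; case/negP: (EU _ e'E).
  by rewrite -[e'](subKr a) memvB.
- split; last first.
    apply: contra (EU _ eE) => /(subvP UU') h.
    by rewrite -[e](addrK a) memvB.
  move=> /(subvP UU') h; case/negP: (EU _ eE).
  by rewrite -[e](subrK a) memvD.
have [h1 h2] := hEE _ _ eE e'E; split; first by move/(subvP UU').
by apply: contra h2; apply: (subvP UU').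
Qed.

End Complement.

Section Bound.
Variables (R : rcfType) (V : vectType R) (B : {dot V for idfun}).
Variables (W : {fset 'End(V)}) (Phi : {fset V}).
Hypotheses (hW : finite_reflection_group B W) (hPhi : root_system_of B W Phi).

(** Write a = v - w v. As v and w v have the same length, s_a exchanges them, so
    s_a w fixes v as well as all the vectors fixed by w, which are orthogonal to
    a. *)
Lemma moved_srefl a w : w \in W -> a \in Phi -> a \in moved w ->
  (\dim (moved (srefl B a \o w)%VF) < \dim (moved w))%N.
Proof.
move=> wW aP aU; have [v ev] := movedP _ _ aU.
pose K := fixedSpace w; pose K' := fixedSpace (srefl B a \o w)%VF.
have KK' : (K <= K')%VS.
  apply/subvP => u; rewrite !mem_fix comp_lfunE => /eqP e.
  by rewrite e srefl_orth // (moved_orth hW hPhi wW aU e).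
have vK' : v \in K'.
  rewrite mem_fix comp_lfunE; have -> : w v = v - a by rewrite ev opprB addrC subrK.
  have haa : B a a != 0 by rewrite dot_eq0 (root_neq0 hPhi).
  have h : 2 * B a v = B a a.
    have := groupW_isom hW hPhi v v wW; have -> : w v = v - a by rewrite ev opprB addrC subrK.
    rewrite !(dotDl, dotDr, dotNl, dotNr) (dotC B v a) => h.
    by apply/eqP; rewrite -subr_eq0; apply/eqP; lra.
  have h' : 2 * B a (v - a) / B a a = - 1.
    by rewrite dotDr dotNr mulrDr h; field.
  by rewrite sreflE h' scaleN1r opprK subrK.
have vK : v \notin K.
  rewrite mem_fix; apply/negP => /eqP e.
  by move: ev; rewrite e subrr => a0; have := root_neq0 hPhi aP; rewrite a0 eqxx.
have hd : (\dim K < \dim K')%N.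
  rewrite ltn_neqAle dimvS // andbT; apply: contraNN vK => /eqP e.
  suff -> : K = K' by [].
  by apply/eqP; rewrite eqEdim KK' e leqnn.
rewrite -(ltn_add2l (\dim K)) !dim_fixed_moved.
by rewrite -(dim_fixed_moved (srefl B a \o w)%VF) ltn_add2r.
Qed.

Hypothesis hirr : irreducible_roots B Phi.
Hypothesis hspan : <<Phi>>%VS = fullv.

Lemma pow_moved (w : 'End(V)) k a : pow w k a - a \in moved w.
Proof.
elim: k => [|k ih]; first by rewrite /= id_lfunE subrr mem0v.
rewrite /= comp_lfunE -[_ - a](subrKA (pow w k a)) memvD //.
by rewrite -memvN opprB; apply/movedP; exists (pow w k a).
Qed.

(** Count the roots not vanishing at x inside the moved space U of w and outside
    it. Inside, w has at least dim U inversions for a suitable vector p, and each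
    of them takes at x a value in the sector Im z > 0 > Im (l z); so its b
    translates by powers of w are roots not counted for another inversion.
    Outside, choose roots not vanishing at x that complete U to V: as w acts
    trivially modulo U, they and their opposites lie in different orbits, each of
    size at least b. *)
Lemma minimal_bound b l x w : (0 < b)%N -> principal b l -> x != 0 -> w \in W ->
  cextend w x = l *: x ->
  {in Phi, forall a, a \in moved w -> cval B a x != 0} ->
  (b * (\dim (moved w) + (\dim {:V} - \dim (moved w)).*2) <= root_count B Phi x)%N.
Proof.
move=> b0 lp x0 wW + hreg.
(* Rotating x makes the nonzero values of roots at x nonreal. *)
wlog hIm : x x0 hreg / {in Phi, forall a, cval B a x != 0 -> Im (cval B a x) != 0}.
  have [t _ ht] := upper_bound
    [seq - Im (cval B a x) / Re (cval B a x) | a <- Phi].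
  pose c : R[i] := 1 +i* t => hw.
  have c0 : c != 0 by rewrite eq_complex /= oner_eq0.
  have hc a : (cval B a (c *: x) != 0) = (cval B a x != 0).
    by rewrite cvalZ mulf_eq0 (negbTE c0).
  move=> e; have <- : root_count B Phi (c *: x) = root_count B Phi x.
    rewrite /root_count; congr (#|` _|); apply/fsetP => a.
    by rewrite !in_support hc.
  apply: hw; last by rewrite cextendZ e !scalerA mulrC.
  - by rewrite scaler_eq0 (negbTE c0).
  - by move=> a aP aU; rewrite hc; apply: hreg.
  move=> a aP; rewrite hc cvalZ => z0.
  have := ht _ (map_f _ aP); move: z0.
  case: (cval B a x) => u v; rewrite eq_complex /= mul1r => z0 hlt.
  apply/eqP => h; have [u0|u0] := eqVneq u 0.
    by move: z0; rewrite u0 eqxx /=; move: h; rewrite u0 mulr0 addr0 => ->; rewrite eqxx.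
  move: hlt; rewrite (_ : - v / u = t) ?ltxx //.
  apply: (mulIf u0); rewrite mulfVK //; apply/eqP; rewrite -subr_eq0 -oppr_eq0.
  by apply/eqP; rewrite -h; ring.
move=> wx; set U := moved w.
have [p0 wp0 hp0] : exists2 q, w q = q &
    {in [seq a <- Phi | a \notin U], forall a, B a q != 0}.
  have [] := @generic_vector R V B (fixedSpace w) [seq a <- Phi | a \notin U].
    move=> a; rewrite mem_filter => /andP[aU _].
    by have [k kw hk] := not_moved hW hPhi wW aU; exists k; rewrite ?mem_fix ?kw.
  by move=> q /fixedSpaceP ? ?; exists q.
have [M M0 hM] := upper_bound
  ([seq `|B a x.2| / `|B a p0| | a <- Phi] ++
   [seq `|B a (w x.2)| / `|B a p0| | a <- Phi]).
(* The term M p0 decides the sign of the roots outside U, and it does so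
   in the same way at p and at w p. *)
pose p := M *: p0 + x.2.
have wp : w p = M *: p0 + w x.2 by rewrite linearD linearZ /= wp0.
have hsg (s y : R) : y != 0 -> `|s| / `|y| < M ->
    (0 < M * y + s) = (0 < y) /\ M * y + s != 0.
  move=> y0; rewrite ltr_pdivrMr ?normr_gt0 // => hlt.
  have [y1|y1] := ltrP 0 y.
    move: hlt; rewrite (gtr0_norm y1) ltr_norml => /andP[h1 h2].
    have h : 0 < M * y + s by lra.
    by rewrite h gt_eqF.
  have y2 : y < 0 by rewrite lt_neqAle y0.
  move: hlt; rewrite (ltr0_norm y2) ltr_norml => /andP[h1 h2].
  have h : M * y + s < 0 by lra.
  by rewrite lt_eqF // ltNge ltW.
have hpU a : a \in Phi -> a \in U -> B a p0 = 0.
  by move=> aP aU; apply: (moved_orth hW hPhi wW aU).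
have hp a : a \in Phi -> B a p != 0.
  move=> aP; rewrite dotDr dotZr; have [aU|aU] := boolP (a \in U).
    rewrite (hpU a) // mulr0 add0r.
    by have := hIm a aP (hreg a aP aU); rewrite cvalE.
  apply: (hsg _ _ _ _).2; first by apply: hp0; rewrite mem_filter aU.
  by apply: hM; rewrite mem_cat (map_f (fun a => _ / _)).
pose I := [seq a <- Phi | a \in inversions B Phi p w].
have hI a : a \in I -> [/\ a \in Phi, a \in U, 0 < Im (cval B a x) &
    Im (l * cval B a x) < 0].
  rewrite mem_filter in_inversions => /andP[/and3P[aP h1 h2] _].
  have aU : a \in U.
    apply/negPn/negP => aU; have ap0 : B a p0 != 0 by apply: hp0; rewrite mem_filter aU.
    move: h1 h2; rewrite wp !dotDr !dotZr => h1 h2.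
    have [|e _] := hsg (B a x.2) _ ap0.
      by apply: hM; rewrite mem_cat (map_f (fun a => _ / _)).
    have [|e' _] := hsg (B a (w x.2)) _ ap0.
      by apply: hM; rewrite mem_cat orbC (map_f (fun a => `|B a (w x.2)| / _)).
    by move: h2; rewrite ltNge ltW // e' -e.
  split=> //.
    by move: h1; rewrite dotDr dotZr hpU // mulr0 add0r cvalE.
  rewrite -cvalZ -wx cvalE /=.
  by move: h2; rewrite wp dotDr dotZr hpU // mulr0 add0r.
have szI : (\dim U <= size I)%N.
  apply: leq_trans (rank_le_inversions hW hPhi hp wW) _.
  apply: uniq_leq_size => [|a]; first exact: fset_uniq.
  by move=> h; rewrite mem_filter h; move: h; rewrite in_inversions => /and3P[].
have [E [uE EX hE EU hEE]] := complement_family U (support_span hPhi hirr hspan x0).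
have hEX a : a \in E -> (a \in Phi) && (cval B a x != 0).
  by move/EX; rewrite mem_filter andbC.
have lb := prim_expr_order (let: And3 h _ _ := lp in h).
have l0 : l != 0 by apply: contra_eq_neq lb => ->; rewrite expr0n gtn_eqF // eq_sym oner_eq0.
pose T := I ++ (E ++ map -%R E).
have hT a : a \in T -> (a \in Phi) && (cval B a x != 0).
  rewrite !mem_cat => /or3P[/hI[aP aU _ _]|/hEX //|/mapP[e /hEX/andP[eP ez] ->]].
    by rewrite aP hreg.
  by rewrite (rootN hPhi) // cvalN oppr_eq0.
have TU a : a \in T -> (a \in I /\ a \in U) \/
    a \notin U /\ exists2 e, e \in E & a = e \/ a = - e.
  rewrite !mem_cat => /or3P[aI|aE|/mapP[e eE ->]].
  - by left; have [] := hI _ aI.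
  - by right; split; [exact: EU | exists a => //; left].
  - by right; rewrite memvN EU //; split=> //; exists e => //; right.
have uT : uniq T.
  rewrite !cat_uniq filter_uniq ?fset_uniq // uE map_inj_uniq ?uE; last exact: oppr_inj.
  rewrite andbT /=; apply/andP; split; apply/hasPn => a.
    rewrite mem_cat => /orP[/EU aU|/mapP[e /EU eU ->]].
      by apply: contra aU => /hI[].
    by apply: contra eU => /hI[_]; rewrite memvN.
  case/mapP => e eE ->; apply/negP => h; have [_] := hEE _ _ eE h.
  by rewrite subrr mem0v.
have inj a a' j j' : a \in T -> a' \in T -> (j < b)%N -> (j' < b)%N ->
    pow w j a = pow w j' a' -> a = a' /\ j = j'.
  move=> aT a'T jb j'b e; have /andP[aP az] := hT _ aT.
  pose mu := l ^+ j' / l ^+ j.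
  have lj0 : l ^+ j != 0 by rewrite expf_neq0.
  have emu : cval B a' x = mu * cval B a x.
    rewrite -(cval_pow hW hPhi j a wW wx) -(cval_pow hW hPhi j' a' wW wx) e.
    by rewrite mulrA mulfVK.
  (* The values at x of a and a' differ by the factor mu, a b-th root of unity. *)
  suff mu1 : mu = 1.
    have ej : j = j'.
      apply/eqP; rewrite -(modn_small jb) -(modn_small j'b).
      rewrite -(eq_prim_root_expr (let: And3 h _ _ := lp in h)).
      by apply/eqP; rewrite -[LHS]mul1r -mu1 mulfVK.
    split=> //; apply: (groupW_inj hW (pow_inW hW j wW)).
    by rewrite e ej.
  have aa' : a - a' \in U.
    have -> : a - a' = (pow w j' a' - a') - (pow w j a - a).
      by rewrite e opprB [RHS]addrC subrKA.
    by rewrite memvB // pow_moved.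
  have [[aI aU]|[aU [c cE ec]]] := TU _ aT.
    have a'U : a' \in U by rewrite -[a'](subKr a) memvB.
    have [[a'I _]|[]] := TU _ a'T; last by rewrite a'U.
    have [_ _ h1 h2] := hI _ aI; have [_ _ h1' h2'] := hI _ a'I.
    rewrite emu in h1' h2'.
    apply: (principal_sector b0 lp _ h1 h2 h1' h2').
    have lk k : (l ^+ k) ^+ b = 1 by rewrite exprAC lb expr1n.
    by rewrite /mu expr_div_n !lk divr1.
  have [[_ a'U]|[_ [c' c'E ec']]] := TU _ a'T.
    by case/negP: aU; rewrite -[a](subrK a') memvD.
  suff ea : a = a' by apply: (mulIf az); rewrite mul1r -emu ea.
  case: ec aa' => ->; case: ec' => ->.
  - by case: (hEE _ _ cE c'E) => h _ /h.
  - by rewrite opprK => h; case: (hEE _ _ cE c'E) => _; rewrite h.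
  - rewrite -opprD memvN => h; by case: (hEE _ _ cE c'E) => _; rewrite h.
  - by rewrite -opprD memvN => h; case: (hEE _ _ cE c'E) => /(_ h) ->.
apply: leq_trans (orbit_count hW hPhi wW wx uT hT inj).
rewrite leq_mul2l !size_cat size_map -hE addKn addnn leq_add2r szI.
exact: orbT.
Qed.

(** Replace w by a power so that the eigenvalue becomes principal, and then by an
    element of least moved space U with this eigenvalue at x. If a root of U
    vanished at x, its reflection would fix x, and multiplying by it would shrink
    U. So minimal_bound applies; the codimension of U that it counts twice shows
    that equality forces U = V. *)
Theorem root_count_bound b l x w : b.-primitive_root l -> x != 0 -> w \in W ->
  cextend w x = l *: x ->
  (b * \dim {:V} <= root_count B Phi x)%N /\
  (root_count B Phi x = (b * \dim {:V})%N ->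
     {in Phi, forall a, cval B a x != 0}).
Proof.
move=> lp x0 wW wx; have b0 := prim_order_gt0 lp.
have [m mp] := principal_ex lp.
have [k ek] := prim_rootP lp (prim_expr_order (let: And3 h _ _ := mp in h)).
have [g [gW gx] gmin] := ex_min_measure (P := fun g => g \in W /\ cextend g x = m *: x)
  (fun g => \dim (moved g)) (ex_intro _ (pow w k) (conj (pow_inW hW k wW)
    (etrans (pow_eigen k wx) (congr1 (fun c => c *: x) (esym ek))))).
have greg : {in Phi, forall a, a \in moved g -> cval B a x != 0}.
  move=> a aP aU; apply/negP => az; have := moved_srefl gW aP aU.
  rewrite ltnNge gmin //; split; first by rewrite (groupMW hW) // (srefl_inW hPhi).
  move: az; rewrite cval_eq0 => /andP[/eqP h1 /eqP h2].
  rewrite cextendM gx cextendZ; congr (_ *: _); case: (x) h1 h2 => u v /= h1 h2.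
  by rewrite /cextend /= !srefl_orth.
have hb := minimal_bound b0 mp x0 gW gx greg.
have hd : (\dim (moved g) <= \dim {:V})%N by rewrite dimvS // subvf.
have h2 : (\dim (moved g) + (\dim {:V} - \dim (moved g)).*2 =
    \dim {:V} + (\dim {:V} - \dim (moved g)))%N.
  by rewrite -addnn addnA subnKC.
rewrite h2 in hb; split; first by apply: leq_trans hb; rewrite leq_mul2l leq_addr orbT.
move=> e; rewrite e leq_pmul2l // -[X in (_ <= X)%N]addn0 leq_add2l leqn0 subn_eq0 in hb.
move=> a aP; apply: greg => //; suff -> : moved g = fullv by rewrite memvf.
by apply/eqP; rewrite eqEdim subvf hb.
Qed.

End Bound.

(** * The least eigenvalue of a Gram matrix *)

Section Perron.
Variables (R : rcfType) (n : nat) (G : 'M[R]_n).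
Hypothesis Gsym : forall i j, G i j = G j i.

Local Notation toC := (real_complex R).
Local Open Scope sesquilinear_scope.

Definition qform (y : 'I_n -> R) : R := \sum_i \sum_j y i * G i j * y j.

(** The spectral theorem gives an orthonormal complex eigenbasis with real
    eigenvalues; the real or the imaginary part of an eigenvector is a nonzero
    real eigenvector. *)
Lemma least_eigenvalue : (0 < n)%N -> exists mu (u : 'I_n -> R),
  [/\ exists i, u i != 0, forall j, \sum_i u i * G i j = mu * u j &
      forall y, mu * (\sum_i y i ^+ 2) <= qform y].
Proof.
move=> n0; pose Gc : 'M[R[i]]_n := map_mx toC G.
have conj_toC m k (A : 'M[R]_(m, k)) : map_mx Num.Def.conjC (map_mx toC A) = map_mx toC A.
  by apply/matrixP => i j; rewrite !mxE; apply/CrealP; rewrite complex_real.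
have hermG : Gc \is hermsymmx.
  apply/is_hermitianmxP; rewrite expr0 scale1r -map_trmx conj_toC.
  by apply/matrixP => i j; rewrite !mxE Gsym.
have /hermitian_normalmx /orthomx_spectralP eG := hermG.
set P := spectralmx Gc in eG; set D := spectral_diag Gc in eG.
have Pu : P \is unitarymx := spectral_unitarymx Gc.
have Dreal : D \is a mxOver Num.real := hermitian_spectral_diag_real hermG.
have DE i : D 0 i = (Re (D 0 i))%:C.
  by apply/esym/RRe_real; exact: (mxOverP Dreal).
case: (@arg_minP _ _ _ (Ordinal n0) xpredT (fun i => Re (D 0 i)) isT) => i0 _ imin.
set mu := Re (D 0 i0) in imin.
have hPG : row i0 P *m Gc = D 0 i0 *: row i0 P.
  have -> : row i0 P *m Gc = row i0 (P *m Gc) by rewrite row_mul.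
  rewrite eG !mulmxA mulmxV ?unitarymx_unit // mul1mx row_mul.
  by apply/rowP => j; rewrite row_diag_mx -scalemxAl -rowE mxE.
have hrow j : \sum_i P i0 i * (G i j)%:C = mu%:C * P i0 j.
  have /rowP/(_ j) := hPG; rewrite [in RHS]DE !mxE => <-.
  by apply: eq_bigr => i _; rewrite !mxE.
have [k hk] : exists k, P i0 k != 0.
  apply/existsP; apply: contraT; rewrite negb_exists => /forallP h.
  have /matrixP/(_ i0 i0)/eqP := unitarymxP Pu; rewrite !mxE eqxx big1.
    by rewrite eq_sym oner_eq0.
  by move=> j _; have := h j; rewrite negbK => /eqP ->; rewrite mul0r.
have hpsd y : mu * (\sum_i y i ^+ 2) <= qform y.
  pose yr : 'rV[R]_n := \row_i y i; pose yc := map_mx toC yr.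
  have ycT : yc ^t* = map_mx toC yr^T.
    by rewrite map_trmx conj_toC.
  have invP : invmx P = P ^t* := invmx_unitary Pu.
  pose z := yc *m invmx P.
  have zT : z ^t* = P *m yc ^t*.
    by rewrite /z invP trmx_mul map_mxM trmxCK.
  have e1 : (qform y)%:C = \sum_i (Re (D 0 i))%:C * (z 0 i * Num.conj (z 0 i)).
    have -> : (qform y)%:C = (yc *m Gc *m yc ^t*) 0 0.
      rewrite ycT -!map_mxM mxE; congr (_ %:C); rewrite mxE /qform exchange_big.
      apply: eq_bigr => i _; rewrite !mxE mulr_suml.
      by apply: eq_bigr => j _; rewrite !mxE.
    rewrite eG !mulmxA -/z -mulmxA -mulmxA -zT mulmxA mxE.
    apply: eq_bigr => i _; rewrite mul_mx_diag !mxE -DE; ring.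
  have e2 : (\sum_i y i ^+ 2)%:C = \sum_i (z 0 i * Num.conj (z 0 i)).
    have -> : (\sum_i y i ^+ 2)%:C = (yc *m yc ^t*) 0 0.
      rewrite ycT -!map_mxM mxE; congr (_ %:C); rewrite mxE.
      by apply: eq_bigr => i _; rewrite !mxE.
    have -> : yc *m yc ^t* = z *m z ^t*.
      by rewrite zT mulmxA /z mulmxKV // unitarymx_unit.
    by rewrite mxE; apply: eq_bigr => i _; rewrite !mxE.
  rewrite -lecR rmorphM /= e1 e2 mulr_sumr; apply: ler_sum => i _.
  by rewrite ler_wpM2r ?mul_conjC_ge0 // lecR imin.
have [re|re] := eqVneq (Re (P i0 k)) 0; last first.
  exists mu, (fun i => Re (P i0 i)); split=> //; first by exists k.
  move=> j; have := congr1 Re (hrow j); rewrite Re_sum.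
  case: (P i0 j) => c d /=; rewrite mul0r subr0 => <-.
  by apply: eq_bigr => i _; case: (P i0 i) => ? ? /=; rewrite mulr0 subr0.
exists mu, (fun i => Im (P i0 i)); split=> //.
  exists k; apply: contraNneq hk => im.
  by move: re im; case: (P i0 k) => c d /= -> ->.
move=> j; have := congr1 Im (hrow j); rewrite Im_sum.
case: (P i0 j) => c d /=; rewrite mul0r addr0 => <-.
by apply: eq_bigr => i _; case: (P i0 i) => ? ? /=; rewrite mulr0 add0r.
Qed.

(** A quadratic function that is nonnegative everywhere and vanishes at 0 has no
    linear term. *)
Lemma linear_coef0 (g h : R) : (forall t, 0 <= 2 * t * g + t ^+ 2 * h) -> g = 0.
Proof.
move=> H; apply/eqP/negPn/negP => g0.
have h1 : 0 < 1 + `|h| by rewrite ltr_pwDl.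
pose t := - g / (1 + `|h|).
have et : t * (1 + `|h|) = - g by rewrite /t mulfVK ?gt_eqF.
have hh : h <= `|h| := ler_norm h.
have t0 : 0 < t ^+ 2.
  rewrite exprn_even_gt0 //=; apply: contraNneq g0 => t0.
  by rewrite -oppr_eq0 -et t0 mul0r.
have := H t; have -> : g = - (t * (1 + `|h|)) by rewrite et opprK.
have : 0 <= t ^+ 2 * `|h| by rewrite mulr_ge0 // ltW.
have : t ^+ 2 * h <= t ^+ 2 * `|h| by rewrite ler_pM2l.
nra.
Qed.

Hypothesis Goff : forall i j, i != j -> G i j <= 0.
Hypothesis Girr : forall S : {set 'I_n}, S != set0 -> S != setT ->
  exists i j, [/\ i \in S, j \notin S & G i j != 0].

(** Replacing an eigenvector for the least eigenvalue by its absolute value does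
    not increase the quadratic form, because the off-diagonal coefficients are
    nonpositive; so the absolute value is an eigenvector too. Its zeros would
    disconnect the matrix. *)
Lemma perron : (0 < n)%N -> exists mu (m : 'I_n -> R),
  (forall i, 0 < m i) /\ forall i, \sum_j G i j * m j = mu * m i.
Proof.
move=> n0; have [mu [u [[k uk] hu hpsd]]] := least_eigenvalue n0.
pose m : 'I_n -> R := fun i => `|u i|; exists mu, m.
have m0 i : 0 <= m i by apply: normr_ge0.
have qm : qform m <= mu * \sum_i m i ^+ 2.
  have -> : mu * \sum_i m i ^+ 2 = qform u.
    rewrite mulr_sumr /qform exchange_big; apply: eq_bigr => j _.
    by rewrite -mulr_suml hu /m real_normK ?num_real // expr2 mulrA.
  apply: ler_sum => i _; apply: ler_sum => j _.
  have [->|ij] := eqVneq i j.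
    by rewrite mulrAC [X in _ <= X]mulrAC -!expr2 /m real_normK ?num_real.
  rewrite mulrAC [X in _ <= X]mulrAC ler_wnM2r ?Goff //.
  by rewrite /m -normrM ler_norm.
have eqm i : \sum_j G i j * m j = mu * m i.
  apply/eqP; rewrite -subr_eq0; apply/eqP.
  apply: (@linear_coef0 _ (G i i - mu)) => t.
  pose y : 'I_n -> R := fun j => m j + t * (j == i)%:R.
  have ey1 : \sum_j y j ^+ 2 = \sum_j m j ^+ 2 + 2 * t * m i + t ^+ 2.
    rewrite (bigD1 i) //= [X in X + _ + _](bigD1 i) //= /y eqxx mulr1.
    rewrite (eq_bigr (fun j => m j ^+ 2)); first by ring.
    by move=> j /negbTE ->; rewrite mulr0 addr0.
  have ey2 : qform y = qform m + 2 * t * (\sum_j G i j * m j) + t ^+ 2 * G i i.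
    have d1 (F : 'I_n -> R) : \sum_j (j == i)%:R * F j = F i.
      rewrite (bigD1 i) //= eqxx mul1r big1 ?addr0 // => j /negbTE ->.
      by rewrite mul0r.
    have -> : qform y = \sum_a ((\sum_b m a * G a b * m b) +
       t * (m a * G a i) + (a == i)%:R * (t * (\sum_b G a b * m b) + t ^+ 2 * G a i)).
      apply: eq_bigr => a _; rewrite -(d1 (fun b => m a * G a b)) -(d1 (fun b => G a b)).
      rewrite !mulr_sumr -!big_split /= mulr_sumr -big_split /=.
      apply: eq_bigr => b _; by rewrite /y; ring.
    rewrite !big_split /= d1 -mulr_sumr.
    have -> : \sum_a m a * G a i = \sum_j G i j * m j.
      by apply: eq_bigr => a _; rewrite mulrC Gsym.
    rewrite /qform; ring.
  have eQ : qform m = mu * \sum_j m j ^+ 2 by apply/eqP; rewrite eq_le qm; exact: (hpsd m).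
  have := hpsd y; rewrite ey1 ey2 eQ; lra.
split=> // i; rewrite lt_neqAle m0 andbT eq_sym.
pose S := [set i | m i != 0].
suff eS : S = setT by have : i \in S by [rewrite eS inE]; rewrite inE.
apply/eqP/negPn/negP => ST.
have [|a [b [aS bS ab]]] := Girr _ ST.
  by apply/set0Pn; exists k; rewrite inE normr_eq0.
move: aS bS; rewrite !inE negbK => ma /eqP mb.
have := eqm b; rewrite mb mulr0 => /eqP; apply/negP; rewrite lt_eqF //.
rewrite (bigD1 a) //= ltr_nwDl //.
  rewrite lt_neqAle mulf_neq0 ?(Gsym b a) //=.
  rewrite mulr_le0_ge0 // Goff //; apply: contraNneq ma => ->; exact/eqP.
rewrite sumr_le0 // => j _; have [->|jb] := eqVneq j b; first by rewrite mb mulr0.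
by rewrite mulr_le0_ge0 // Goff // eq_sym.
Qed.

End Perron.

(** * The Coxeter graph *)

Section Coxeter.
Variables (R : rcfType) (V : vectType R) (B : {dot V for idfun}).
Variables (W : {fset 'End(V)}) (Phi : {fset V}).
Hypotheses (hW : finite_reflection_group B W) (hPhi : root_system_of B W Phi).
Hypothesis hirr : irreducible_roots B Phi.
Hypothesis hspan : <<Phi>>%VS = fullv.

Lemma regular_vector_ex : exists p, {in Phi, forall a, B a p != 0}.
Proof.
have [] := @generic_vector R V B fullv Phi.
  by move=> a aP; exists a; rewrite ?memvf // dot_eq0 (root_neq0 hPhi).
by move=> q _ hq; exists q.
Qed.

Variable p : V.
Hypothesis hp : forall a, a \in Phi -> B a p != 0.
Variable D : seq V.
Hypothesis hD : simple_system B Phi p D.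

Let uD : uniq D. Proof. by case: hD. Qed.
Let simpleP d : d \in D -> d \in Phi. Proof. exact: (simple_root hD). Qed.

(** Put c = - 2 (a, b) / (a, a). If 0 < c < 1, then s_b s_a b equals
    c a - (1 - c^2) b, a root with coefficients of both signs. *)
Lemma simple_edge a b : a \in D -> b \in D -> a != b -> B a b != 0 ->
  2 * B a b <= - B a a.
Proof.
move=> aD bD ab ab0; have aP := simpleP aD; have bP := simpleP bD.
have aa : 0 < B a a by rewrite dot_gt0 (root_neq0 hPhi).
have ebb : B b b = B a a by apply: (root_norm hPhi).
have hab : B a b < 0 by rewrite lt_neqAle ab0 (simple_obtuse hPhi hp hD).
rewrite leNgt; apply/negP => hlt.
pose c := - (2 * B a b / B a a).
have c0 : 0 < c by rewrite oppr_gt0 pmulr_llt0 ?invr_gt0 // pmulr_rlt0.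
have c1 : c < 1 by rewrite ltrNl ltr_pdivlMr // mulN1r.
have c2 : 0 < 1 - c ^+ 2 by rewrite subr_gt0 expr_lt1 // ltW.
have e1 : srefl B a b = b + c *: a by rewrite sreflE scaleNr.
have e2 : srefl B b (srefl B a b) = c *: a - (1 - c ^+ 2) *: b.
  rewrite e1 sreflE dotDr dotZr ebb (dotC B b a).
  have -> : 2 * (B a a + c * B a b) / B a a = 2 - c ^+ 2.
    have -> : 2 - c ^+ 2 = 2 - c * c by ring.
    rewrite {2}/c; field; by rewrite gt_eqF.
  rewrite [b + _]addrC -addrA; congr (_ + _).
  by rewrite -{1}[b]scale1r -scalerBl -scaleNr; congr (_ *: _); ring.
have gP : srefl B b (srefl B a b) \in Phi by rewrite !(root_srefl hPhi).
have [h1|h1] := root_pos_or_neg hPhi hp gP.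
  apply: (@simple_ray _ _ _ _ _ _ hD a c (srefl B b (srefl B a b)) ((1 - c ^+ 2) *: b)) => //.
  - exact: (posroot_cone hD).
  - apply: coneZ; first exact: ltW.
    by apply: cone_mem; [exact: rem_uniq | rewrite mem_rem_uniq // !inE eq_sym ab].
  - by rewrite dotZl mulr_gt0 // (simple_gt0 hD).
  - by rewrite e2 [RHS]addrC subrK.
apply: (@simple_ray _ _ _ _ _ _ hD b (1 - c ^+ 2) (- srefl B b (srefl B a b)) (c *: a)) => //.
- exact: (posroot_cone hD).
- apply: coneZ; first exact: ltW.
  by apply: cone_mem; [exact: rem_uniq | rewrite mem_rem_uniq // !inE ab].
- by rewrite dotZl mulr_gt0 // (simple_gt0 hD).
- by rewrite e2 opprB [RHS]addrC subrK.
Qed.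

(** The Coxeter graph is a forest: if every vertex of S had two neighbours in S,
    then simple_edge would make the squared length of the sum of S nonpositive. *)
Lemma simple_leaf (S : seq V) : uniq S -> {subset S <= D} -> S != [::] ->
  exists2 a, a \in S & (count (fun b => B a b != 0%R) (rem a S) <= 1)%N.
Proof.
move=> uS SD S0; pose v := \sum_(a <- S) a.
have vp : 0 < B v p.
  rewrite dot_suml; case: S uS SD S0 {v} => // a S _ SD _.
  rewrite big_cons ltr_pwDl ?(simple_gt0 hD) ?SD ?mem_head //.
  rewrite big_seq sumr_ge0 // => b bS; rewrite ltW // (simple_gt0 hD) // SD //.
  by rewrite inE bS orbT.
have vv : 0 < B v v.
  by rewrite dot_gt0; apply: contraTneq vp => ->; rewrite dot0l ltxx.
have [[a aS ha]|hn] := boolp.pselect (exists2 a, a \in S & 0 < B a v); last first.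
  move: vv; rewrite {1}/v dot_suml ltNge big_seq sumr_le0 // => a aS.
  by rewrite leNgt; apply/negP => h; apply: hn; exists a.
exists a => //; rewrite leqNgt; apply/negP => hc; move: ha; apply/negP; rewrite -leNgt.
have aP := simpleP (SD _ aS).
rewrite dot_sumr (big_rem _ aS) /=.
have h T : {subset T <= rem a S} ->
    2 * (\sum_(b <- T) B a b) <= - ((count (fun b => B a b != 0) T)%:R * B a a).
  elim: T => [|b T ih] hT; first by rewrite big_nil mulr0 mul0r oppr0.
  have hb : b \in rem a S by apply: hT; rewrite mem_head.
  rewrite big_cons mulrDr /= natrD [X in - X]mulrDl opprD lerD //; last first.
    by apply: ih => x xT; apply: hT; rewrite inE xT orbT.
  have [->|ab0] := eqVneq (B a b) 0; first by rewrite mulr0 mul0r oppr0.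
  rewrite mul1r; move: hb; rewrite mem_rem_uniq // !inE => /andP[ba bS].
  by apply: simple_edge => //; rewrite ?SD // eq_sym.
have := h _ (fun x hx => hx); set N := count _ _ in hc *.
have : 2%:R <= N%:R :> R by rewrite ler_nat.
have aa := dot_ge0 B a => hN h1.
have : 2%:R * B a a <= N%:R * B a a by rewrite ler_wpM2r.
lra.
Qed.

(** Colour all but a leaf, and give the leaf the colour that its neighbour does
    not have. *)
Lemma simple_coloring (S : seq V) : uniq S -> {subset S <= D} ->
  exists col : V -> bool, {in S &, forall a b, a != b -> B a b != 0 -> col a != col b}.
Proof.
have [n] := ubnP (size S); elim: n S => [//|n ih] S sz uS SD.
have [->|S0] := eqVneq S [::]; first by exists xpredT.
have [a aS ha] := simple_leaf uS SD S0.
have [|||col hcol] := ih (rem a S).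
- by rewrite size_rem //; case: (S) aS sz.
- exact: rem_uniq.
- by move=> x /mem_rem /SD.
pose nb := [seq b <- rem a S | B a b != 0].
exists (fun x => if x == a then ~~ col (head a nb) else col x).
have key b : b \in S -> b != a -> B a b != 0 -> ~~ col (head a nb) != col b.
  move=> bS ba ab; suff -> : head a nb = b by case: (col b).
  have : b \in nb by rewrite mem_filter ab mem_rem_uniq // !inE ba.
  by move: ha; rewrite -size_filter -/nb; case: nb => [|c [|]] //= _; rewrite inE => /eqP.
move=> b c bS cS bc h; have [eb|ba] := eqVneq b a.
  rewrite eb in bc h *; rewrite [c == a]eq_sym (negbTE bc); apply: key => //; by rewrite eq_sym.
have [ec|ca] := eqVneq c a.
  by rewrite eq_sym; apply: key => //; rewrite dotC -ec.
by apply: hcol; rewrite // mem_rem_uniq // !inE ?ba ?ca.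
Qed.

Lemma word_orthogonal (T : seq V) v : uniq T ->
  {in T &, forall a b, a != b -> B a b = 0} ->
  word B T v = v - \sum_(a <- T) (2 * B a v / B a a) *: a.
Proof.
elim: T => [|a T ih] /=; first by rewrite id_lfunE big_nil subr0.
case/andP=> aT uT hT; rewrite comp_lfunE ih //; last first.
  by move=> b c bT cT; apply: hT; rewrite inE ?bT ?cT orbT.
rewrite big_cons opprD addrA linearB /= sreflE; congr (_ - _).
rewrite srefl_orth // dot_sumr big_seq big1 // => b bT.
have ab : a != b by apply: contraNneq aT => ->.
by rewrite dotZr (hT a b) ?mulr0 ?inE ?eqxx ?bT ?orbT.
Qed.

(** By posroot_ind, every root lies in the span of one of two orthogonal parts of
    a simple system. *)
Lemma simple_irreducible (S : pred V) : (exists2 a, a \in D & S a) ->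
  (exists2 a, a \in D & ~~ S a) ->
  exists a b, [/\ a \in D, b \in D, S a, ~~ S b & B a b != 0].
Proof.
move=> [a1 a1D a1S] [a2 a2D a2S]; apply: boolp.contrapT => hn.
pose D1 := [seq d <- D | S d]; pose D2 := [seq d <- D | ~~ S d].
have orth d1 d2 : d1 \in D1 -> d2 \in D2 -> B d1 d2 = 0.
  rewrite !mem_filter => /andP[h1 d1D] /andP[h2 d2D].
  apply/eqP/negPn/negP => h; apply: hn; by exists d1, d2.
have orthS u v : u \in <<D1>>%VS -> v \in <<D2>>%VS -> B u v = 0.
  move=> /(@coord_span _ _ _ (in_tuple D1)) -> /(@coord_span _ _ _ (in_tuple D2)) ->.
  rewrite dot_suml big1 // => i _; rewrite dot_sumr big1 // => j _.
  by rewrite dotZl dotZr orth ?mulr0 // mem_nth.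
have cover b : posroot B Phi p b -> (b \in <<D1>>%VS) || (b \in <<D2>>%VS).
  apply: (posroot_ind hPhi hp hD (P := fun b => (b \in <<D1>>%VS) || (b \in <<D2>>%VS))) =>
    [d dD|a g aD _].
    have [dS|dS] := boolP (S d); first by rewrite memv_span // mem_filter dS.
    by rewrite orbC memv_span // mem_filter dS.
  have [aS|aS] := boolP (S a).
    have aU : a \in <<D1>>%VS by rewrite memv_span // mem_filter aS.
    case/orP=> gU; first by rewrite sreflE memvB // memvZ.
    by rewrite srefl_orth ?gU ?orbT // (orthS _ _ aU gU).
  have aU : a \in <<D2>>%VS by rewrite memv_span // mem_filter aS.
  case/orP=> gU; last by rewrite sreflE [X in _ || X]memvB ?orbT // memvZ.
  by rewrite srefl_orth ?gU // dotC (orthS _ _ gU aU).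
pose P1 := [fset a in Phi | a \in <<D1>>%VS]%fset.
pose P2 := [fset a in Phi | a \in <<D2>>%VS]%fset.
case: hirr => _; apply; exists P1, P2; split.
- apply/fset0Pn; exists a1; rewrite !inE /= simpleP //=.
  by rewrite memv_span // mem_filter a1S.
- apply/fset0Pn; exists a2; rewrite !inE /= simpleP //=.
  by rewrite memv_span // mem_filter a2S.
- apply/fsetP => a; rewrite !inE /= -andb_orr; case aP: (a \in Phi) => //=.
  have [/cover -> //|/cover] := root_pos_or_neg hPhi hp aP.
  by rewrite !memvN => ->.
by move=> u v; rewrite !inE /= => /andP[_ uU] /andP[_ vU]; apply: orthS.
Qed.

(** The coordinates m are a positive eigenvector of the Gram matrix of D. The
    vector with these coordinates lies in the open chamber of D, which is why the
    plane built from it below is orthogonal to no root. *)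
Lemma perron_vector : Phi != fset0 -> exists mu (m : V -> R),
  [/\ 0 < mu, {in D, forall d, 0 < m d} &
      {in D, forall d, B d (\sum_(e <- D) m e *: e) = mu * m d}].
Proof.
move=> Phi0; pose n := size D; pose a (i : 'I_n) := D`_i.
have aD i : a i \in D by apply: mem_nth.
have n0 : (0 < n)%N.
  rewrite lt0n; apply: contraNneq Phi0 => /size0nil D0.
  apply/eqP/fsetP => b; rewrite inE; apply/negP => bP.
  have h c : posroot B Phi p c -> False.
    move=> cpos; have [k _ ec] := posroot_cone hD cpos.
    by case/andP: cpos => _; rewrite ec D0 big_nil dot0l ltxx.
  by case: (root_pos_or_neg hPhi hp bP) => /h.
pose G : 'M[R]_n := \matrix_(i, j) B (a i) (a j).
have inj : injective a.
  by move=> i j /eqP; rewrite nth_uniq // => /eqP/val_inj.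
have Gsym i j : G i j = G j i by rewrite !mxE dotC.
have Goff i j : i != j -> G i j <= 0.
  move=> ij; rewrite mxE (simple_obtuse hPhi hp hD) //.
  by rewrite (inj_eq inj).
have aE d : d \in D -> exists i, d = a i.
  move=> dD; have hi : (index d D < n)%N by rewrite index_mem.
  by exists (Ordinal hi); rewrite /a nth_index.
have Girr (S : {set 'I_n}) : S != set0 -> S != setT ->
    exists i j, [/\ i \in S, j \notin S & G i j != 0].
  move=> /set0Pn[i iS]; rewrite -properT => /properP[_ [j _ jS]].
  have [||u [v [/aE[i' ->] /aE[j' ->]]]] :=
    @simple_irreducible (fun d => d \in [seq a k | k in S]).
  - by exists (a i) => //; apply: image_f.
  - by exists (a j) => //; rewrite mem_image.
  by rewrite !mem_image // => ? ? ?; exists i', j'; rewrite mxE.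
have [mu [c [c0 hc]]] := perron Gsym Goff Girr n0.
pose m d := if insub (index d D) is Some i then c i else 0.
have mE i : m (a i) = c i.
  rewrite /m /a index_uniq // insubT //= => hi; congr (c _); exact: val_inj.
have hv i : B (a i) (\sum_(e <- D) m e *: e) = mu * c i.
  rewrite -hc dot_sumr (big_nth 0) big_mkord; apply: eq_bigr => j _.
  by rewrite dotZr -/(a j) mE mxE mulrC.
exists mu, m; split.
- pose v := \sum_(e <- D) m e *: e.
  have vp : 0 < B v p.
    rewrite /v dot_suml (big_nth 0) big_mkord (bigD1 (Ordinal n0)) //=.
    rewrite ltr_wpDr //.
      rewrite sumr_ge0 // => j _; rewrite dotZl -/(a j) mE mulr_ge0 // ltW //.
      exact: (simple_gt0 hD).
    by rewrite dotZl -/(a (Ordinal n0)) mE mulr_gt0 // (simple_gt0 hD).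
  have vv : 0 < B v v.
    by rewrite dot_gt0; apply: contraTneq vp => ->; rewrite dot0l ltxx.
  have e : B v v = mu * \sum_i c i ^+ 2.
    rewrite {1}/v dot_suml (big_nth 0) big_mkord mulr_sumr; apply: eq_bigr => j _.
    by rewrite dotZl -/(a j) mE hv; ring.
  rewrite e pmulr_lgt0 // in vv.
  rewrite (bigD1 (Ordinal n0)) //= ltr_wpDr ?exprn_gt0 // sumr_ge0 // => j _.
  exact: sqr_ge0.
- by move=> d /aE[i ->]; rewrite mE.
by move=> d /aE[i ->]; rewrite hv mE.
Qed.

End Coxeter.

(** * A bipartite Coxeter element *)

Section CoxeterElement.
Variables (R : rcfType) (V : vectType R) (B : {dot V for idfun}).
Variables (W : {fset 'End(V)}) (Phi : {fset V}).
Hypotheses (hW : finite_reflection_group B W) (hPhi : root_system_of B W Phi).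

Lemma pow_add (w : 'End(V)) i j v : pow w (i + j) v = pow w i (pow w j v).
Proof. by rewrite !powE iterD. Qed.

Lemma pow_mul1 (w : 'End(V)) b i : pow w b = \1%VF -> pow w (b * i) = \1%VF.
Proof.
move=> e; apply/lfunP => v; elim: i => [|i ih]; first by rewrite muln0.
by rewrite mulnS pow_add ih e !id_lfunE.
Qed.

Lemma groupW_order w : w \in W -> exists2 k, (0 < k)%N & pow w k = \1%VF.
Proof.
move=> wW; have powW k := pow_inW hW k wW.
pose s := [seq pow w k | k <- iota 0 #|` W|.+1].
have : ~~ uniq s.
  apply/negP => us; have : (size s <= size W)%N.
    by apply: uniq_leq_size => // _ /mapP[k _ ->].
  by rewrite size_map size_iota ltnn.
case/(uniqPn \1%VF) => i [j [ij]]; rewrite size_map size_iota => hj.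
have hi := ltn_trans ij hj.
rewrite !(nth_map 0%N) ?size_iota // !nth_iota // !add0n => e.
exists (j - i)%N; first by rewrite subn_gt0.
apply/lfunP => v; apply: (groupW_inj hW (powW i)).
by rewrite -pow_add subnKC ?e ?id_lfunE // ltnW.
Qed.

Variable p : V.
Hypothesis hp : forall a, a \in Phi -> B a p != 0.

(** The sum of an orbit is fixed by c, hence zero, so signs change along the
    orbit; where they change from negative to positive there is an inversion. *)
Lemma roots_le_inversions c b : c \in W -> (forall v, c v = v -> v = 0) ->
  (0 < b)%N -> pow c b = \1%VF -> (#|` Phi| <= b * #|` inversions B Phi p c|)%N.
Proof.
move=> cW cfix b0 cb; have cmod i v : pow c (i %% b) v = pow c i v.
  rewrite [in RHS](divn_eq i b) mulnC pow_add (pow_mul1 _ cb) id_lfunE //.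
set I := inversions B Phi p c.
pose S := [seq pow c i a | a <- I, i <- iota 0 b].
have -> : (b * #|` I|)%N = size S.
  by rewrite size_allpairs size_iota mulnC.
apply: uniq_leq_size => [|a aP]; first exact: fset_uniq.
pose f j := B (pow c j a) p.
have cP j : pow c j a \in Phi by rewrite (rootW hPhi) // (pow_inW hW).
have f0 j : f j != 0 by apply: hp.
have fb j i : f (j + b * i)%N = f j.
  by rewrite /f pow_add (pow_mul1 _ cb) id_lfunE.
have fsum : \sum_(j < b) f j = 0.
  have -> : \sum_(j < b) f j = B (\sum_(j < b) pow c j a) p by rewrite dot_suml.
  rewrite (cfix (\sum_(j < b) pow c j a)) ?dot0l // linear_sum /=.
  have e j : c (pow c j a) = pow c j.+1 a by rewrite /= comp_lfunE.
  rewrite (eq_bigr (fun j : 'I_b => pow c j.+1 a)) => [|j _]; last exact: e.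
  case: (b) b0 cb => // k _ ck; rewrite big_ord_recr [RHS]big_ord_recl /= addrC.
  congr (_ + _).
  exact: (congr1 (fun g : 'End(V) => g a) ck).
have [j fj fj1] : exists2 j, f j < 0 & 0 < f j.+1.
  apply: boolp.contrapT => hn.
  have step j : f j < 0 -> f j.+1 < 0.
    move=> h; rewrite lt_neqAle f0 leNgt; apply/negP => h'; apply: hn; by exists j.
  have up j i : f j < 0 -> f (j + i)%N < 0.
    by move=> h; elim: i => [|i ih]; rewrite ?addn0 // addnS step.
  have [[j fj]|hpos] := boolp.pselect (exists j, f j < 0).
    have neg i : f i < 0.
      rewrite -(fb i j); have le : (j <= i + b * j)%N.
        by rewrite (leq_trans (leq_pmull j b0)) // leq_addl.
      by rewrite -(subnKC le) up.
    have : \sum_(i < b) f i < 0.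
      rewrite -(prednK b0) big_ord_recl ltr_nwDl // sumr_le0 // => i _; exact: ltW.
    by rewrite fsum ltxx.
  have pos i : 0 < f i.
    rewrite lt_neqAle eq_sym f0 leNgt; apply/negP => h; apply: hpos; by exists i.
  have : 0 < \sum_(i < b) f i.
    rewrite -(prednK b0) big_ord_recl ltr_pwDl // sumr_ge0 // => i _; exact: ltW.
  by rewrite fsum ltxx.
pose k := (b * j.+1 - j.+1)%N.
have hk : (k + j.+1 = b * j.+1)%N by rewrite subnK // leq_pmull.
apply/allpairsP; exists (pow c j.+1 a, (k %% b)%N) => /=; split.
- have h := cP j.+1; have h' := fj1; rewrite /f /= in h h' *.
  by rewrite in_inversions h h' comp_lfunE (groupW_isom hW hPhi).
- by rewrite mem_iota add0n ltn_pmod.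
- by rewrite cmod -(pow_add c _ j.+1) hk (pow_mul1 _ cb) id_lfunE.
Qed.

Variable D : seq V.
Hypothesis hD : simple_system B Phi p D.

Lemma inversions_word ss : {subset ss <= D} ->
  (#|` inversions B Phi p (word B ss)| <= size ss)%N.
Proof.
elim: ss => [|a ss ih] h.
  rewrite leqn0 cardfs_eq0; apply/eqP/fsetP => a; rewrite in_inversions inE id_lfunE.
  by apply/negP => /and3P[_ /lt_trans h1 /h1]; rewrite ltxx.
have aD : a \in D by apply: h; rewrite mem_head.
apply: leq_trans (inversions_srefl_le hPhi hp hD _ aD) _.
have -> : (srefl B a \o word B (a :: ss))%VF = word B ss.
  apply/lfunP => v; rewrite comp_lfunE word_cons sreflK //.
  by rewrite (root_neq0 hPhi) // (simple_root hD).
by rewrite ltnS ih // => x xs; apply: h; rewrite inE xs orbT.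
Qed.

Hypothesis hirr : irreducible_roots B Phi.
Hypothesis hspan : <<Phi>>%VS = fullv.

(** Let c = c1 c2, where c1 and c2 are the products of the reflections in the two
    colour classes; each class consists of orthogonal roots. Split the Perron
    vector as v = a + e along the classes. Then c1 and c2 preserve the span of a
    and e, on which c has determinant 1 and trace k^2 - 2 with k^2 < 4. If k <> 0
    the eigenvalues are not real, and a root vanishing at an eigenvector would
    vanish on the whole plane, in particular at v, which is regular. If k = 0
    then c v = - v. *)
Lemma coxeter_eigenvector : exists c x (l : R[i]),
  [/\ c \in W, x != 0, cextend c x = l *: x, {in Phi, forall a, cval B a x != 0} &
      (forall v, c v = v -> v = 0) /\ (#|` inversions B Phi p c| <= \dim {:V})%N].
Proof.
have uD : uniq D by case: hD.
have szD : size D = \dim {:V}.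
  have := simple_free hPhi hp hD; rewrite /free => /eqP <-.
  by rewrite (simple_span hPhi hp hD hspan).
have Phi0 : Phi != fset0 by case: hirr.
have [mu [m [mu0 m0 hv]]] := perron_vector hPhi hirr hp hD Phi0.
have [col hcol] := simple_coloring hPhi hp hD uD (fun x h => h).
pose D1 := [seq d <- D | col d]; pose D2 := [seq d <- D | ~~ col d].
have D1D d : d \in D1 -> d \in D by rewrite mem_filter => /andP[].
have D2D d : d \in D2 -> d \in D by rewrite mem_filter => /andP[].
have u1 : uniq D1 by rewrite filter_uniq.
have u2 : uniq D2 by rewrite filter_uniq.
have o1 : {in D1 &, forall a b, a != b -> B a b = 0}.
  move=> a b; rewrite !mem_filter => /andP[ca aD] /andP[cb bD] ab.
  by apply/eqP/negPn/negP => h; have := hcol a b aD bD ab h; rewrite ca cb.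
have o2 : {in D2 &, forall a b, a != b -> B a b = 0}.
  move=> a b; rewrite !mem_filter => /andP[ca aD] /andP[cb bD] ab.
  by apply/eqP/negPn/negP => h; have := hcol a b aD bD ab h; rewrite (negbTE ca) (negbTE cb).
pose c := word B (D1 ++ D2); exists c.
have cE v : c v = word B D1 (word B D2 v) by rewrite /c word_cat.
have cW : c \in W.
  apply: (word_inW hW hPhi) => d; rewrite mem_cat => /orP[/D1D|/D2D]; exact: (simple_root hD).
have c_inv : (#|` inversions B Phi p c| <= \dim {:V})%N.
  apply: leq_trans (inversions_word _) _.
    by move=> d; rewrite mem_cat => /orP[/D1D|/D2D].
  by rewrite size_cat !size_filter count_predC szD.
have d0N a b : a \in D -> b \in D -> B a a = B b b.
  by move=> aD bD; apply: (root_norm hPhi); apply: (simple_root hD).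
have Dgt0 a : a \in D -> 0 < B a a.
  by move=> aD; rewrite dot_gt0 (root_neq0 hPhi) // (simple_root hD).
have split12 (F : V -> V) : \sum_(d <- D) F d = \sum_(d <- D1) F d + \sum_(d <- D2) F d.
  by rewrite (bigID col) !big_filter.
have cfix v : c v = v -> v = 0.
  have pD : perm_eq (D1 ++ D2) D by rewrite perm_filterC.
  have fD : free (D1 ++ D2) by rewrite (perm_free pD) (simple_free hPhi hp hD).
  move/(word_free_fix fD) => vD; apply/eqP; rewrite -(dot_eq0 B); apply/eqP.
  have : v \in <<D>>%VS by rewrite (simple_span hPhi hp hD hspan) memvf.
  move/(@coord_span _ _ _ (in_tuple D)) => {1}->.
  rewrite dot_suml big1 // => i _; rewrite dotZl vD ?mulr0 //.
  by rewrite (perm_mem pD) mem_nth.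
have [d0 d0D] : exists d, d \in D.
  case/fset0Pn: Phi0 => b bP; have h y : posroot B Phi p y -> exists d, d \in D.
    by move=> /(simple_dot_gt0 hPhi hD) [d dD _]; exists d.
  by case: (root_pos_or_neg hPhi hp bP) => /h.
pose N := B d0 d0; have N0 : 0 < N := Dgt0 _ d0D.
pose k := 2 * (mu - N) / N.
pose v := \sum_(d <- D) m d *: d.
pose a := \sum_(d <- D1) m d *: d; pose e := \sum_(d <- D2) m d *: d.
have vae : v = a + e by rewrite /v split12.
have dota : {in D1, forall d, B d a = m d * N}.
  move=> d dD; rewrite /a dot_sumr (bigD1_seq d) //= dotZr (d0N d d0 (D1D d dD) d0D) -/N.
  rewrite big_seq_cond big1 ?addr0 // => y /andP[yD yd].
  by rewrite dotZr o1 ?mulr0 // eq_sym.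
have dote : {in D2, forall d, B d e = m d * N}.
  move=> d dD; rewrite /e dot_sumr (bigD1_seq d) //= dotZr (d0N d d0 (D2D d dD) d0D) -/N.
  rewrite big_seq_cond big1 ?addr0 // => y /andP[yD yd].
  by rewrite dotZr o2 ?mulr0 // eq_sym.
have dote1 : {in D1, forall d, B d e = (mu - N) * m d}.
  move=> d dD; have := hv d (D1D d dD); rewrite -/v vae dotDr dota // => h.
  by rewrite mulrBl -h; ring.
have dota2 : {in D2, forall d, B d a = (mu - N) * m d}.
  move=> d dD; have := hv d (D2D d dD); rewrite -/v vae dotDr dote // => h.
  by rewrite mulrBl -h; ring.
have c1a : word B D1 a = - a.
  rewrite word_orthogonal //; have -> : \sum_(d <- D1) (2 * B d a / B d d) *: d = 2 *: a.
    rewrite [in RHS]/a scaler_sumr !big_seq; apply: eq_bigr => d dD; rewrite scalerA.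
    by rewrite dota // (d0N d d0 (D1D d dD) d0D) -/N; congr (_ *: _); field; rewrite gt_eqF.
  by rewrite scaler_nat mulr2n opprD addrA subrr add0r.
have c2e : word B D2 e = - e.
  rewrite word_orthogonal //; have -> : \sum_(d <- D2) (2 * B d e / B d d) *: d = 2 *: e.
    rewrite [in RHS]/e scaler_sumr !big_seq; apply: eq_bigr => d dD; rewrite scalerA.
    by rewrite dote // (d0N d d0 (D2D d dD) d0D) -/N; congr (_ *: _); field; rewrite gt_eqF.
  by rewrite scaler_nat mulr2n opprD addrA subrr add0r.
have c1e : word B D1 e = e - k *: a.
  rewrite word_orthogonal //; congr (_ - _).
  rewrite /a scaler_sumr !big_seq; apply: eq_bigr => d dD; rewrite scalerA.
  by rewrite dote1 // (d0N d d0 (D1D d dD) d0D) -/N /k; congr (_ *: _); field; rewrite gt_eqF.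
have c2a : word B D2 a = a - k *: e.
  rewrite word_orthogonal //; congr (_ - _).
  rewrite /e scaler_sumr !big_seq; apply: eq_bigr => d dD; rewrite scalerA.
  by rewrite dota2 // (d0N d d0 (D2D d dD) d0D) -/N /k; congr (_ *: _); field; rewrite gt_eqF.
pose comb (s t : R) := s *: a + t *: e.
have combD s t s' t' : comb s t + comb s' t' = comb (s + s') (t + t').
  by rewrite /comb !scalerDl addrACA.
have combZ r s t : r *: comb s t = comb (r * s) (r * t).
  by rewrite /comb scalerDr !scalerA.
have combN s t : - comb s t = comb (- s) (- t).
  by rewrite /comb !scaleNr opprD.
have c1c s t : word B D1 (comb s t) = comb (- s - t * k) t.
  rewrite /comb linearD !linearZ /= c1a c1e scalerBr scalerA scalerBl scaleNr scalerN.
  by rewrite addrAC addrA.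
have c2c s t : word B D2 (comb s t) = comb s (- t - s * k).
  rewrite /comb linearD !linearZ /= c2a c2e scalerBr scalerA scalerBl scaleNr scalerN.
  by rewrite addrAC addrA.
have cc s t : c (comb s t) = comb (- s - (- t - s * k) * k) (- t - s * k).
  by rewrite cE c2c c1c.
have vroot b : b \in Phi -> B b v != 0.
  have h y : posroot B Phi p y -> B y v != 0.
    move=> yp; rewrite gt_eqF //; apply: (cone_gt0 _ (posroot_cone hD yp)).
      by move=> d dD; rewrite hv // mulr_gt0 // m0.
    by case/andP: yp => /(root_neq0 hPhi).
  move=> bP; have [/h //|/h] := root_pos_or_neg hPhi hp bP.
  by rewrite dotNl oppr_eq0.
have v0 : v != 0 by apply: contraNneq (vroot _ (simple_root hD d0D)) => ->; rewrite dot0r.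
have vcomb : v = comb 1 1 by rewrite /comb !scale1r.
(* This is mu > 0, the positivity of the form. *)
have k2 : - 2 < k.
  by rewrite /k ltr_pdivlMr //; nra.
(* The least eigenvalue mu is at most the diagonal entry N. *)
have kle0 : k <= 0.
  have : mu * m d0 <= N * m d0.
    rewrite -hv // dot_sumr (bigD1_seq d0) //= dotZr -/N mulrC gerDl.
    rewrite big_seq_cond sumr_le0 // => y /andP[yD yd].
    by rewrite dotZr mulr_ge0_le0 ?(ltW (m0 _ yD)) // (simple_obtuse hPhi hp hD) // eq_sym.
  rewrite ler_pM2r ?m0 // => muN; rewrite /k pmulr_lle0 ?invr_gt0 // pmulr_rle0 //.
  by rewrite subr_le0.
have [k0|k0] := eqVneq k 0.
  exists (cembed v), (- 1); split=> //.
  - by apply: contraNneq v0 => -[->].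
  - have cv : c v = - v by rewrite vcomb cc k0 combN; congr comb; ring.
    by rewrite scaleN1r /cextend /= linear0 cv -[in LHS]oppr0.
  - by move=> b bP; rewrite cval_eq0 negb_and /= vroot.
(* The eigenvalue lr + i li is a root of l^2 - (k^2 - 2) l + 1, and the
   eigenvector is - (1 + l) / k a + e. *)
pose lr := (k ^+ 2 - 2) / 2.
have lr2 : 0 < 1 - lr ^+ 2.
  have kk : k ^+ 2 < 4 by nra.
  have kk0 : 0 < k ^+ 2 by rewrite exprn_even_gt0.
  have -> : 1 - lr ^+ 2 = k ^+ 2 * (4 - k ^+ 2) / 4 by rewrite /lr; field.
  by rewrite divr_gt0 // mulr_gt0 // subr_gt0.
pose li := Num.sqrt (1 - lr ^+ 2).
have li2 : li ^+ 2 = 1 - lr ^+ 2 by rewrite sqr_sqrtr // ltW.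
have li0 : li != 0 by rewrite gt_eqF // sqrtr_gt0.
pose sr := - (1 + lr) / k; pose si := - li / k.
have si0 : si != 0 by rewrite mulf_neq0 ?oppr_eq0 ?invr_eq0.
have reg b : b \in Phi -> cval B b (comb sr 1, comb si 0) != 0.
  move=> bP; rewrite cval_eq0 /=; apply/negP => /andP[/eqP h1 /eqP h2].
  move: (vroot b bP); rewrite vae; move: h1 h2.
  rewrite /comb !dotDr !dotZr mul0r addr0 mul1r => h1 /eqP.
  rewrite mulf_eq0 (negbTE si0) /= => /eqP ba.
  by move: h1; rewrite ba mulr0 !add0r => ->; rewrite eqxx.
exists (comb sr 1, comb si 0), (lr +i* li); split=> //.
- apply: contraNneq (reg _ (simple_root hD d0D)) => -> .
  by rewrite cval_eq0 /= dot0r eqxx.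
- have elr : k ^+ 2 = 2 * lr + 2 by rewrite /lr; field.
  have elr' : k * k = 2 * lr + 2 by rewrite -elr.
  have eli : li * li = 1 - lr * lr by rewrite -!expr2.
  have esr : sr * k = - (1 + lr) by rewrite /sr mulfVK.
  have esi : si * k = - li by rewrite /si mulfVK.
  rewrite /cextend /= !cc -[RHS]/(cscale _ _) /cscale /= !combZ combN !combD.
  congr pair; congr comb; apply: (mulIf k0).
  + have -> : (- sr - (-1 - sr * k) * k) * k = - (sr * k) + k * k + (sr * k) * (k * k) by ring.
    have -> : (lr * sr + - (li * si)) * k = lr * (sr * k) - li * (si * k) by ring.
    rewrite esr esi elr'; have -> : li * - li = - (1 - lr * lr) by rewrite mulrN eli.
    ring.
  + by rewrite esr; ring.
  + have -> : (- si - (- 0 - si * k) * k) * k = - (si * k) + (si * k) * (k * k) by ring.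
    have -> : (li * sr + lr * si) * k = li * (sr * k) + lr * (si * k) by ring.
    by rewrite esr esi elr'; ring.
  + by rewrite esi; ring.
Qed.

End CoxeterElement.

Section CoxeterBound.
Variables (R : rcfType) (V : vectType R) (B : {dot V for idfun}).
Variables (W : {fset 'End(V)}) (Phi : {fset V}).
Hypotheses (hW : finite_reflection_group B W) (hPhi : root_system_of B W Phi).
Hypothesis hirr : irreducible_roots B Phi.
Hypothesis hspan : <<Phi>>%VS = fullv.

(** Some real combination of the real and imaginary parts of x is regular, and w
    fixes it. *)
Lemma regular_cstab w x : w \in W -> {in Phi, forall a, cval B a x != 0} ->
  cextend w x = x -> w = \1%VF.
Proof.
move=> wW xreg e.
have [|q qK qreg] := @generic_vector R V B (<[x.1]> + <[x.2]>)%VS Phi.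
  move=> a /xreg; rewrite cval_eq0 negb_and => /orP[h|h].
    by exists x.1 => //; apply: subvP (addvSl _ _) _ (memv_line _).
  by exists x.2 => //; apply: subvP (addvSr _ _) _ (memv_line _).
apply: (regular_stab hW hPhi qreg wW).
have e1 : w x.1 = x.1 by have := congr1 fst e.
have e2 : w x.2 = x.2 by have := congr1 snd e.
case/memv_addP: qK => _ /vlineP[s ->] [_ /vlineP[t ->] ->].
by rewrite linearD !linearZ /= e1 e2.
Qed.

Lemma coxeter_bound : exists c x (l : R[i]) b,
  [/\ c \in W, b.-primitive_root l, x != 0, cextend c x = l *: x &
      (#|` Phi| <= b * \dim {:V})%N].
Proof.
have [p hp] := regular_vector_ex hPhi.
have [D hD] := simple_system_ex B Phi p.
have [c [x [l [cW x0 cx xreg [cfix cinv]]]]] :=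
  coxeter_eigenvector hW hPhi hp hD hirr hspan.
have [k k0 ck] := groupW_order hW cW.
have lk : l ^+ k = 1.
  have := pow_eigen k cx; rewrite ck cextend1 => /esym/eqP.
  rewrite -[X in _ == X]scale1r -subr_eq0 -scalerBl scaler_eq0 (negbTE x0) orbF.
  by rewrite subr_eq0 => /eqP.
have [b bp _] := prim_order_exists k0 lk.
exists c, x, l, b; split=> //.
have cb : pow c b = \1%VF.
  apply: regular_cstab xreg _; first exact: (pow_inW hW).
  by rewrite (pow_eigen b cx) (prim_expr_order bp) scale1r.
apply: leq_trans (roots_le_inversions hW hPhi hp cW cfix (prim_order_gt0 bp) cb) _.
by rewrite leq_mul2l cinv orbT.
Qed.

End CoxeterBound.

(** * Polynomials at complex points *)

Section PolynomialFunctions.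

Lemma poly_all0 (R : numDomainType) (p : {poly R}) : (forall t, p.[t] = 0) -> p = 0.
Proof.
move=> h; apply/eqP/negPn/negP => p0.
have := max_poly_roots p0 (rs := [seq k%:R | k <- iota 0 (size p)]).
rewrite size_map size_iota ltnn => hf; suff: false by []; apply: hf.
  by apply/allP => _ /mapP[k _ ->]; rewrite rootE h.
rewrite map_inj_uniq ?iota_uniq // => i j /eqP; rewrite eqr_nat => /eqP //.
Qed.

(** Induction on the number of variables, seeing p as a polynomial in the last
    one. *)
Lemma mpoly_all0 (R : numDomainType) n (p : {mpoly R[n]}) :
  (forall v, p.@[v] = 0) -> p = 0.
Proof.
elim: n p => [|n ih] p h.
  have := h (fun=> 0); have -> : p = (p@_0%MM)%:MP.
    apply/mpolyP => m; rewrite mcoeffC; have -> : m = 0%MM by apply/mnmP => -[].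
    by rewrite eqxx mulr1.
  by rewrite mevalC => ->.
pose wid (m : 'X_{1..n.+1}) : 'X_{1..n} := [multinom m (widen_ord (leqnSn n) i) | i < n].
have mE : muni p = \sum_(m <- msupp p) p@_m *: 'X_[wid m] *: 'X^(m ord_max).
  exact: muniE.
have hm : muni p = 0.
  apply/polyP => k; rewrite coef0; apply: ih => v.
  suff e : map_poly (meval v) (muni p) = 0.
    by have := congr1 (fun q : {poly R} => q`_k) e; rewrite coef_map coef0.
  apply: poly_all0 => t.
  pose v' (i : 'I_n.+1) := if unlift ord_max i is Some j then v j else t.
  rewrite -(h v') mE rmorph_sum horner_sum mevalE; apply: eq_bigr => m _.
  rewrite -mul_polyC rmorphM /= map_polyC map_polyXn hornerM hornerC hornerXn /=.
  rewrite mevalZ mevalX -mulrA; congr (_ * _).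
  rewrite big_ord_recr /= {2}/v' unlift_none; congr (_ * _).
  apply: eq_bigr => i _; rewrite mnmE; congr (_ ^+ _); rewrite /v'.
  have -> : widen_ord (leqnSn n) i = lift ord_max i.
    by apply/val_inj; rewrite /= /bump leqNgt ltn_ord.
  by rewrite liftK.
apply/mpolyP => m0; rewrite mcoeff0; apply/eqP/negPn/negP => hm0.
have := congr1 (fun q : {poly {mpoly R[n]}} => (q`_(m0 ord_max))@_(wid m0)) hm.
rewrite mE coef_sum raddf_sum /= coef0 mcoeff0.
rewrite (bigD1_seq m0) ?msupp_uniq ?mcoeff_msupp //= big1 => [|m mm0].
  rewrite addr0 coefZ coefXn eqxx mulr1 mcoeffZ mcoeffX eqxx mulr1 => /eqP.
  by rewrite (negbTE hm0).
rewrite coefZ coefXn; have [e|] := eqVneq; last by rewrite mulr0 mcoeff0.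
rewrite mulr1 mcoeffZ mcoeffX; have [e'|] := eqVneq; last by rewrite mulr0.
case/eqP: mm0; apply/mnmP => i; have [j ->|->] := unliftP ord_max i; last by rewrite e.
have := congr1 (fun m : 'X_{1..n} => m j) e'; rewrite !mnmE.
have -> // : widen_ord (leqnSn n) j = lift ord_max j.
by apply/val_inj; rewrite /= /bump leqNgt ltn_ord.
Qed.

Lemma mmap_comp (R : nzRingType) (S T : comNzRingType) n (f : R -> S)
    (g : {rmorphism S -> T}) (h : 'I_n -> S) (p : {mpoly R[n]}) :
  g (mmap f h p) = mmap (g \o f) (g \o h) p.
Proof.
rewrite /mmap rmorph_sum; apply: eq_bigr => m _; rewrite rmorphM; congr (_ * _).
by rewrite /mmap1 rmorph_prod; apply: eq_bigr => i _; rewrite rmorphXn.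
Qed.

Lemma mmap_eq (R S : nzRingType) n (f f' : R -> S) (h h' : 'I_n -> S)
    (p : {mpoly R[n]}) : f =1 f' -> h =1 h' -> mmap f h p = mmap f' h' p.
Proof.
move=> ff hh; apply: eq_bigr => m _; rewrite ff; congr (_ * _).
exact: mmap1_eq.
Qed.

Lemma mmap_homog (R : nzRingType) (S : comNzRingType) n (f : R -> S) (h : 'I_n -> S)
    (p : {mpoly R[n]}) d c : p \is d.-homog ->
  mmap f (fun i => c * h i) p = c ^+ d * mmap f h p.
Proof.
move=> /dhomogP hd; rewrite /mmap mulr_sumr big_seq [RHS]big_seq.
apply: eq_bigr => m /hd em; have {em} <- : mdeg m = d := em.
rewrite mulrCA; congr (_ * _); rewrite /mmap1 mdegE -prodrXr -big_split /=.
by apply: eq_bigr => i _; rewrite exprMn.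
Qed.

End PolynomialFunctions.

Section ComplexEvaluation.
Variables (R : rcfType) (V : vectType R) (B : {dot V for idfun}).
Local Notation n := (\dim {:V}).
Local Notation toC := (real_complex R).
Implicit Types (x y : complexification V) (v : V).

Definition vcoord (v : V) (i : 'I_n) : R := coord (vbasis {:V}) i v.

Lemma vcoordE v : v = \sum_i vcoord v i *: (vbasis {:V})`_i.
Proof. by rewrite {1}(coord_vbasis (memvf v)). Qed.

Lemma vcoord_comb (c : 'I_n -> R) i : vcoord (\sum_i c i *: (vbasis {:V})`_i) i = c i.
Proof. by rewrite /vcoord coord_sum_free // (basis_free (vbasisP _)). Qed.

Definition ccoord x (i : 'I_n) : R[i] := vcoord x.1 i +i* vcoord x.2 i.

Definition cpolyval (p : {mpoly R[n]}) x : R[i] := mmap toC (ccoord x) p.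

Lemma cpolyval_sum I (r : seq I) F x :
  cpolyval (\sum_(i <- r) F i) x = \sum_(i <- r) cpolyval (F i) x.
Proof. by rewrite /cpolyval rmorph_sum. Qed.

Lemma cpolyvalX p k x : cpolyval (p ^+ k) x = cpolyval p x ^+ k.
Proof. by rewrite /cpolyval rmorphXn. Qed.

Lemma cpolyval_comp (q : {mpoly R[n]}) (f : n.-tuple {mpoly R[n]}) x :
  cpolyval (q \mPo f) x = mmap toC (fun i => cpolyval (tnth f i) x) q.
Proof.
rewrite /cpolyval /comp_mpoly mmap_comp; apply: mmap_eq => // c /=.
exact: mmapC.
Qed.

Lemma cpolyval_homog p d c x : p \is d.-homog ->
  cpolyval p (c *: x) = c ^+ d * cpolyval p x.
Proof.
move=> hd; rewrite /cpolyval -(mmap_homog _ _ _ hd); apply: mmap_eq => // i.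
rewrite /ccoord /vcoord; case: c => a b /=; simpc.
by congr Complex; rewrite ?linearB ?linearD !linearZ //= addrC.
Qed.

(** On the real line u + t v invariance is a polynomial identity in t, and t may
    then take the value i. *)
Lemma cpolyval_invariant (W : {fset 'End(V)}) p w x : invariant_poly W p -> w \in W ->
  cpolyval p (cextend w x) = cpolyval p x.
Proof.
move=> pinv wW.
pose line (y : complexification V) : {poly R} :=
  mmap (@polyC R) (fun i => (vcoord y.1 i)%:P + vcoord y.2 i *: 'X) p.
have lineR y t : (line y).[t] = polyval p (y.1 + t *: y.2).
  rewrite -[LHS]/(horner_eval t (line y)) mmap_comp; apply: mmap_eq => [c|i] /=.
    by rewrite /horner_eval hornerC.
  by rewrite /horner_eval hornerD hornerC hornerZ hornerX linearD linearZ /= mulrC.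
have lineC y : (map_poly toC (line y)).['i%C] = cpolyval p y.
  rewrite -[LHS]/((horner_eval 'i%C \o map_poly toC) (line y)) mmap_comp.
  apply: mmap_eq => [c|i] /=.
    by rewrite /horner_eval map_polyC hornerC.
  rewrite /horner_eval rmorphD /= map_polyC map_polyZ map_polyX hornerD hornerC.
  by rewrite hornerZ hornerX /ccoord /=; simpc.
rewrite -!lineC; congr (map_poly _ _).[_]; apply/eqP; rewrite -subr_eq0; apply/eqP.
apply: poly_all0 => t; rewrite hornerD hornerN !lineR /=.
by rewrite -linearZ -linearD pinv // subrr.
Qed.

End ComplexEvaluation.

(** * Invariants separate orbits *)

Lemma sum_Complex (R : rcfType) I (r : seq I) (F G : I -> R) :
  \sum_(i <- r) (F i +i* G i) = (\sum_(i <- r) F i) +i* (\sum_(i <- r) G i).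
Proof.
elim: r => [|i r ih]; first by rewrite !big_nil.
by rewrite !big_cons ih; simpc.
Qed.

Section Separation.
Variables (R : rcfType) (V : vectType R) (B : {dot V for idfun}).
Variables (W : {fset 'End(V)}) (Phi : {fset V}).
Hypotheses (hW : finite_reflection_group B W).
Local Notation n := (\dim {:V}).
Local Notation toC := (real_complex R).
Local Notation e_ i := (vbasis {:V})`_i.

Lemma perm_mulW (g : 'End(V)) : g \in W -> perm_eq [seq (w \o g)%VF | w <- W] W.
Proof.
move=> gW; have [g' g'W [gK g'K]] := groupW_inv hW gW.
have u : uniq [seq (w \o g)%VF | w <- W].
  rewrite map_inj_in_uniq ?fset_uniq // => w1 w2 _ _ e.
  apply/lfunP => v; have := congr1 (fun h : 'End(V) => h (g' v)) e.
  by rewrite !comp_lfunE g'K.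
apply: uniq_perm => //; first exact: fset_uniq.
apply: (uniq_min_size u _ _).2; last by rewrite size_map.
by move=> _ /mapP[w wW ->]; apply: (groupMW hW).
Qed.

Definition lform (u : V) (w : 'End(V)) : {mpoly R[n]} :=
  \sum_(i < n) (B u (w (e_ i))) *: 'X_i.

Lemma lform_val u w v : polyval (lform u w) v = B u (w v).
Proof.
rewrite /polyval /lform raddf_sum /= [in RHS](vcoordE v) linear_sum dot_sumr.
by apply: eq_bigr => i _; rewrite mevalZ mevalXU linearZ /= dotZr mulrC.
Qed.

Lemma lform_cpv u w x : cpolyval (lform u w) x = cval B u (cextend w x).
Proof.
rewrite cvalE /= (vcoordE x.1) (vcoordE x.2) !linear_sum -sum_Complex.
rewrite /lform cpolyval_sum; apply: eq_bigr => i _.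
by rewrite /cpolyval mmapZ mmapX mmap1U /ccoord !linearZ /=; simpc; rewrite ![_ * B u _]mulrC.
Qed.

Variables (f : n.-tuple {mpoly R[n]}) (d : n.-tuple nat).
Hypothesis hf : basic_invariants W f d.

Lemma basic_inv i : invariant_poly W (tnth f i).
Proof. by case: hf. Qed.
Lemma basic_homog i : tnth f i \is (tnth d i).-homog.
Proof. by case: hf. Qed.
Lemma basic_indep q : q \mPo f = 0 -> q = 0.
Proof. by case: hf => _ _ h _; apply: h. Qed.
Lemma basic_gen p : invariant_poly W p -> exists q : {mpoly R[n]}, p = q \mPo f.
Proof. by case: hf => _ _ _ h; apply: h. Qed.

Lemma invariant_eq p x y : invariant_poly W p ->
  (forall i, cpolyval (tnth f i) x = cpolyval (tnth f i) y) -> cpolyval p x = cpolyval p y.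
Proof.
by move=> /basic_gen[q ->] h; rewrite !cpolyval_comp; apply: mmap_eq.
Qed.

(** For each difference of two points, u need only be nonorthogonal to a nonzero
    vector among its real and imaginary parts. *)
Lemma separating_functional (s : seq (complexification V)) :
  exists u, {in s &, forall x y, x != y -> cval B u x != cval B u y}.
Proof.
pose rp (z : complexification V) := if z.1 == 0 then z.2 else z.1.
have rp0 z : z != 0 -> rp z != 0.
  rewrite /rp => z0; case: (z.1 =P 0) => [e1|/eqP //]; apply: contraNneq z0 => e2.
  by case: z e1 e2 => z1 z2 /= -> ->.
have [|u _ hu] := @generic_vector R V B fullv
    [seq rp z | z <- [seq (x - y : complexification V) | x <- s, y <- s] & z != 0].
  move=> a /mapP[z + ->]; rewrite mem_filter => /andP[z0 _].
  by exists (rp z); rewrite ?memvf // dot_eq0 rp0.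
exists u => x y xs ys xy; rewrite -subr_eq0.
have -> : cval B u x - cval B u y = cval B u (x - y).
  by rewrite -[y in RHS]scale1r -scaleNr cvalD cvalZ mulN1r.
have zn : x - y != 0 by rewrite subr_eq0.
have := hu (rp (x - y)); rewrite map_f; last first.
  by rewrite mem_filter zn; apply/allpairsP; exists (x, y).
rewrite dotC cval_eq0 /rp => /(_ isT); case: ifP => _ h; rewrite negb_and h //.
exact: orbT.
Qed.

(** For a functional u, the sums over W of the powers of u (w x) are invariants, so
    the sum of g (u (w x)) over W is equal to that of g (u (w y)) for every
    polynomial g. If y is not in the orbit of x, take u separating the two orbits
    and g vanishing at all their points except x: only one of the sums is 0. *)
Lemma invariants_separate x y :
  (forall i, cpolyval (tnth f i) x = cpolyval (tnth f i) y) ->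
  exists2 w, w \in W & cextend w x = y.
Proof.
move=> hxy; apply: boolp.contrapT => hn.
pose s := undup ([seq cextend w x | w <- W] ++ [seq cextend w y | w <- W]).
have [u hu] := separating_functional s.
have xs w : w \in W -> cextend w x \in s.
  by move=> wW; rewrite mem_undup mem_cat (map_f (fun w => cextend w x)).
have ys w : w \in W -> cextend w y \in s.
  by move=> wW; rewrite mem_undup mem_cat orbC (map_f (fun w => cextend w y)).
have xx : x \in s by rewrite -[x]cextend1 xs // (group1W hW).
have psum k : \sum_(w <- W) cval B u (cextend w x) ^+ k =
              \sum_(w <- W) cval B u (cextend w y) ^+ k.
  pose p := \sum_(w <- W) lform u w ^+ k.
  have pE z : cpolyval p z = \sum_(w <- W) cval B u (cextend w z) ^+ k.
    by rewrite cpolyval_sum; apply: eq_bigr => w _; rewrite cpolyvalX lform_cpv.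
  rewrite -!pE; apply: invariant_eq => // g gW v.
  rewrite /polyval !raddf_sum /=.
  rewrite -[in RHS](perm_big _ (perm_mulW gW)) /= big_map; apply: eq_bigr => w _.
  by rewrite !rmorphXn /= -!/(polyval _ _) !lform_val comp_lfunE.
have gsum (g : {poly R[i]}) : \sum_(w <- W) g.[cval B u (cextend w x)] =
    \sum_(w <- W) g.[cval B u (cextend w y)].
  under eq_bigr do rewrite horner_coef; under [RHS]eq_bigr do rewrite horner_coef.
  rewrite exchange_big [RHS]exchange_big /=; apply: eq_bigr => k _.
  by rewrite -!mulr_sumr psum.
pose g := \prod_(z <- s | z != x) ('X - (cval B u z)%:P).
have g0 z : z \in s -> z != x -> g.[cval B u z] = 0.
  move=> zs zx; rewrite /g horner_prod; apply/eqP; rewrite prodf_seq_eq0.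
  by apply/hasP; exists z; rewrite // zx hornerXsubC subrr eqxx.
have gx : g.[cval B u x] != 0.
  rewrite /g horner_prod prodf_seq_neq0; apply/allP => z zs; apply/implyP => zx.
  by rewrite hornerXsubC subr_eq0 hu // eq_sym.
have e0 : \sum_(w <- W) g.[cval B u (cextend w y)] = 0.
  rewrite big_seq big1 // => w wW; rewrite g0 ?ys //; apply/eqP => e.
  have [w' w'W [wK _]] := groupW_inv hW wW; apply: hn; exists w' => //.
  rewrite -e /cextend /= !wK; by case: (y).
move: (gsum g); rewrite e0.
have -> : \sum_(w <- W) g.[cval B u (cextend w x)] =
    g.[cval B u x] *+ count (fun w => cextend w x == x) W.
  rewrite (bigID (fun w => cextend w x == x)) /= [X in _ + X]big_seq_cond.
  rewrite [X in _ + X]big1 ?addr0 => [|w /andP[wW wx]]; last by rewrite g0 ?xs.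
  rewrite (eq_bigr (fun=> g.[cval B u x])) => [|w /eqP -> //].
  by rewrite big_const_seq; elim: (count _ _) => //= k ->; rewrite mulrS.
move/eqP; rewrite mulrn_eq0 (negbTE gx) orbF => /eqP c0.
have : has (fun w => cextend w x == x) W.
  by apply/hasP; exists \1%VF; rewrite ?(group1W hW) // cextend1.
by rewrite has_count c0.
Qed.

(** An invariant of degree 0 is a constant c, and 'X_i - c would be an algebraic
    relation. *)
Lemma degree_gt0 i : (0 < tnth d i)%N.
Proof.
rewrite lt0n; apply/negP => /eqP di.
have fi : tnth f i = ((tnth f i)@_0%MM)%:MP.
  apply/mpolyP => m; rewrite mcoeffC; have [->|m0] := eqVneq; first by rewrite mulr1.
  rewrite mulr0; apply: (dhomog_nemf_coeff (basic_homog i)).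
  by rewrite di /= mdeg_eq0.
set c := _@_0%MM in fi.
have /basic_indep q0 : ('X_i - c%:MP) \mPo f = 0.
  by rewrite rmorphB /= comp_mpolyXU comp_mpolyC -tnth_nth fi subrr.
have := congr1 (meval (fun=> c + 1)) q0; rewrite mevalB mevalXU mevalC meval0.
by rewrite addrC addKr => /eqP; rewrite oner_eq0.
Qed.

Lemma basic_at0 i : cpolyval (tnth f i) 0 = 0.
Proof.
by rewrite -[0 in LHS](scale0r 0) (cpolyval_homog _ _ (basic_homog i)) expr0n
   gtn_eqF ?degree_gt0 // mul0r.
Qed.

(** Since f (x) = f (w x) = l^d f (x), a basic invariant whose degree d is not a
    multiple of b vanishes at x; they cannot all vanish, as x is not in the orbit
    of 0. *)
Lemma eigen_order_dvd b l x w : b.-primitive_root l -> x != 0 -> w \in W ->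
  cextend w x = l *: x -> exists i, (b %| tnth d i)%N.
Proof.
move=> lp x0 wW wx; apply: boolp.contrapT => hn.
have [i|g gW] := @invariants_separate 0 x.
  rewrite basic_at0; have := cpolyval_invariant x (basic_inv i) wW.
  rewrite wx (cpolyval_homog _ _ (basic_homog i)) => /eqP.
  rewrite -subr_eq0 -[X in _ - X]mul1r -mulrBl mulf_eq0 subr_eq0.
  rewrite -(prim_order_dvd lp) => /orP[h|/eqP //].
  by case: hn; exists i.
move=> e; case/negP: x0; rewrite -e /cextend /= !linear0; exact: eqxx.
Qed.

End Separation.

(** * Common zeros of the basic invariants *)

Section ProperIdeals.
Variables (A : comNzRingType).
Implicit Types (I J : A -> Prop).

Definition ideal I := [/\ I 0, forall a b, I a -> I b -> I (a + b) &
  forall a b, I b -> I (a * b)].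

Lemma idealN I a : ideal I -> I a -> I (- a).
Proof. by case=> _ _ h /(h (-1)); rewrite mulN1r. Qed.

Lemma ideal_sum I T (r : seq T) F : ideal I -> (forall i, I (F i)) ->
  I (\sum_(i <- r) F i).
Proof.
move=> [h0 hD _] h; elim: r => [|i r ih]; first by rewrite big_nil.
by rewrite big_cons; apply: hD.
Qed.

Lemma ideal_congM I a b a' b' : ideal I -> I (a - b) -> I (a' - b') ->
  I (a * a' - b * b').
Proof.
move=> [h0 hD hM] h h'; have -> : a * a' - b * b' = a' * (a - b) + b * (a' - b') by ring.
by apply: hD; apply: hM.
Qed.

Lemma ideal_congX I a b k : ideal I -> I (a - b) -> I (a ^+ k - b ^+ k).
Proof.
move=> hI h; elim: k => [|k ih]; first by rewrite !expr0 subrr; case: hI.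
by rewrite !exprS; apply: ideal_congM.
Qed.

Lemma ideal_cong_mmap I (S : nzRingType) n (phi : S -> A) (h h' : 'I_n -> A)
    (p : {mpoly S[n]}) : ideal I -> (forall i, I (h i - h' i)) ->
  I (mmap phi h p - mmap phi h' p).
Proof.
move=> hI hh; have [h0 hD hM] := hI.
rewrite /mmap -sumrB; apply: ideal_sum => // m; rewrite -mulrBr; apply: hM.
rewrite /mmap1; elim/big_rec2: _ => [|i a b _ ih]; first by rewrite subrr.
by apply: ideal_congM => //; apply: ideal_congX.
Qed.

(** If each factor x - c generated with I the unit ideal, then so would their
    product, which is in I. *)
Lemma adjoin_factor I (x : A) (cs : seq A) : ideal I -> ~ I 1 ->
  I (\prod_(c <- cs) (x - c)) ->
  exists c J, [/\ c \in cs, ideal J, ~ J 1, forall a, I a -> J a & J (x - c)].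
Proof.
move=> hI I1 hp; have [h0 hD hM] := hI.
have [[c cs_c hc]|hn] := boolp.pselect
    (exists2 c, c \in cs & ~ exists a, I (1 - a * (x - c))).
  exists c, (fun b => exists a, I (b - a * (x - c))); split=> //.
  - split; first by exists 0; rewrite mul0r subrr.
      move=> b b' [a ha] [a' ha']; exists (a + a').
      have -> : b + b' - (a + a') * (x - c) = (b - a * (x - c)) + (b' - a' * (x - c)) by ring.
      exact: hD.
    move=> d b [a ha]; exists (d * a); rewrite -mulrA -mulrBr; exact: hM.
  - by move=> a ha; exists 0; rewrite mul0r subr0.
  - by exists 1; rewrite mul1r subrr.
exfalso; apply: I1.
have [a ha] : exists a, I (1 - a * \prod_(c <- cs) (x - c)).
  have {hp hn} hn c : c \in cs -> exists a, I (1 - a * (x - c)).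
    by move=> cc; apply: boolp.contrapT => h; apply: hn; exists c.
  elim: cs hn => [|c cs ih] hn.
    by exists 1; rewrite big_nil mulr1 subrr.
  have [|a ha] := ih; first by move=> e ee; apply: hn; rewrite inE ee orbT.
  have [a' ha'] := hn c (mem_head _ _); exists (a' * a).
  rewrite big_cons; set P := \prod_(_ <- _) _ in ha *.
  have -> : 1 - a' * a * ((x - c) * P) = (1 - a' * (x - c)) + (a' * (x - c)) * (1 - a * P) by ring.
  by apply: hD => //; apply: hM.
by rewrite -[1](subrK (a * \prod_(c <- cs) (x - c))); apply: hD => //; apply: hM.
Qed.

End ProperIdeals.

Section Nullstellensatz.
Variables (C : closedFieldType) (n : nat).
Local Notation A := {mpoly C[n]}.

(** Modulo I each variable is a root of a split polynomial, so adjoin_factor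
    assigns values to the variables one at a time while the ideal stays proper. *)
Lemma integral_nullstellensatz (I : A -> Prop) : ideal I -> ~ I 1 ->
  (forall k, exists2 g : {poly C}, g \is monic & I (map_poly (@mpolyC n C) g).['X_k]) ->
  exists z : 'I_n -> C, forall p, I p -> p.@[z] = 0.
Proof.
move=> hI I1 hint.
have [J [z [hJ J1 IJ Jz]]] : exists J (z : 'I_n -> C), [/\ ideal J, ~ J 1,
    forall p, I p -> J p & forall k, k \in enum 'I_n -> J ('X_k - (z k)%:MP)].
  elim: (enum 'I_n) => [|k s [J [z [hJ J1 IJ Jz]]]]; first by exists I, (fun=> 0).
  have [g gm hg] := hint k.
  have [r er] := closed_field_poly_normal g.
  have hfact : J (\prod_(c <- [seq c%:MP | c <- r]) ('X_k - c)).
    apply: IJ; suff -> : \prod_(c <- [seq c%:MP | c <- r]) ('X_k - c) =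
      (map_poly (@mpolyC n C) g).['X_k] by [].
    rewrite er (monicP gm) scale1r rmorph_prod horner_prod big_map.
    by apply: eq_bigr => c _; rewrite rmorphB /= map_polyX map_polyC hornerXsubC.
  have [_ [J' [/mapP[c _ ->] hJ' J'1 JJ' Jc]]] := adjoin_factor hJ J1 hfact.
  exists J', (fun i => if i == k then c else z i); split=> //.
    by move=> p /IJ/JJ'.
  move=> i; rewrite inE; case: eqP => [->|_] //= /Jz; exact: JJ'.
exists z => p /IJ Jp; apply/eqP/negPn/negP => pz; apply: J1.
have [h0 hD hM] := hJ.
have h1 : J (p - (p.@[z])%:MP).
  have {1}<- : mmap (@mpolyC n C) (fun i => 'X_i) p = p.
    rewrite -[in RHS](comp_mpoly_id p); apply: mmap_eq => // i.
    by rewrite tnth_mktuple.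
  have -> : (p.@[z])%:MP = mmap (@mpolyC n C) (fun i => (z i)%:MP) p.
    rewrite -[LHS]/((@mpolyC n C) (mmap idfun z p)) mmap_comp; exact: mmap_eq.
  by apply: ideal_cong_mmap => // i; apply: Jz; rewrite mem_enum.
have h2 : J (p.@[z])%:MP.
  have -> : (p.@[z])%:MP = p + - (p - (p.@[z])%:MP) :> A by rewrite opprB addrC subrK.
  by apply: hD => //; apply: idealN.
have -> : 1 = (p.@[z])^-1%:MP * (p.@[z])%:MP :> A by rewrite -mpolyCM mulVf.
exact: hM.
Qed.

End Nullstellensatz.

Section BasicPoint.
Variables (R : rcfType) (V : vectType R) (B : {dot V for idfun}).
Variables (W : {fset 'End(V)}).
Hypotheses (hW : finite_reflection_group B W).
Local Notation n := (\dim {:V}).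
Local Notation toC := (real_complex R).
Local Notation e_ i := (vbasis {:V})`_i.

Lemma vcoord_basis (i k : 'I_n) : vcoord (e_ i) k = (i == k)%:R.
Proof. by rewrite /vcoord coord_free // (basis_free (vbasisP _)). Qed.

Lemma meval_map_mpoly (z : 'I_n -> R[i]) (p : {mpoly R[n]}) :
  (map_mpoly toC p).@[z] = mmap toC z p.
Proof.
rewrite /map_mpoly -[LHS]/(meval z _) mmap_comp; apply: mmap_eq => [c|i] /=.
  exact: mevalC.
exact: mevalXU.
Qed.

Lemma meval_real (v : V) (p : {mpoly R[n]}) :
  mmap toC (fun i => (vcoord v i)%:C) p = (polyval p v)%:C.
Proof. by rewrite -[RHS]/(toC (mmap idfun (vcoord v) p)) mmap_comp. Qed.

Lemma mpoly_eq0_val (p : {mpoly R[n]}) : (forall v, polyval p v = 0) -> p = 0.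
Proof.
move=> h; apply: mpoly_all0 => c; rewrite -(h (\sum_i c i *: e_ i)).
by apply: meval_eq => i; rewrite -[RHS]/(vcoord _ i) vcoord_comb.
Qed.

Definition lcoord (w : 'End(V)) (k : 'I_n) : {mpoly R[n]} :=
  \sum_(j < n) vcoord (w (e_ j)) k *: 'X_j.

Lemma lcoord_val w k v : polyval (lcoord w k) v = vcoord (w v) k.
Proof.
rewrite /polyval /lcoord raddf_sum /= [in RHS](vcoordE v) /vcoord linear_sum linear_sum.
by apply: eq_bigr => i _; rewrite mevalZ mevalXU !linearZ /= mulrC.
Qed.

Lemma lcoord1 k : lcoord \1%VF k = 'X_k.
Proof.
rewrite /lcoord (bigD1 k) //= id_lfunE vcoord_basis eqxx scale1r big1 ?addr0 // => j jk.
by rewrite id_lfunE vcoord_basis (negbTE jk) scale0r.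
Qed.

Definition psubst (w : 'End(V)) (p : {mpoly R[n]}) := p \mPo [tuple lcoord w k | k < n].

Lemma psubst_val w p v : polyval (psubst w p) v = polyval p (w v).
Proof.
rewrite /polyval /psubst comp_mpoly_meval; apply: meval_eq => k.
by rewrite tnth_mktuple -[LHS]/(polyval _ _) lcoord_val.
Qed.

Definition re_mpoly (g : {mpoly R[i][n]}) : {mpoly R[n]} :=
  \sum_(m <- msupp g) Re g@_m *: 'X_[m].

Lemma re_mpoly_val g v : polyval (re_mpoly g) v = Re g.@[fun i => (vcoord v i)%:C].
Proof.
rewrite /polyval /re_mpoly raddf_sum mevalE Re_sum; apply: eq_bigr => m _ /=.
rewrite mevalZ mevalX.
have -> : \prod_i (vcoord v i)%:C ^+ m i = (\prod_i vcoord v i ^+ m i)%:C.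
  by rewrite rmorph_prod; apply: eq_bigr => i _; rewrite rmorphXn.
by case: (g@_m) => a b /=; rewrite mulr0 subr0.
Qed.

Variables (f : n.-tuple {mpoly R[n]}) (d : n.-tuple nat).
Hypothesis hf : basic_invariants W f d.
Variable e : 'I_n -> R.

Let F i : {mpoly R[i][n]} := map_mpoly toC (tnth f i) - ((e i)%:C)%:MP.
Let I (p : {mpoly R[i][n]}) := exists g, p = \sum_i g i * F i.

Let I_ideal : ideal I.
Proof.
split.
- by exists (fun=> 0); rewrite big1 // => i _; rewrite mul0r.
- move=> _ _ [g ->] [g' ->]; exists (fun i => g i + g' i).
  by rewrite -big_split; apply: eq_bigr => i _; rewrite mulrDl.
move=> a _ [g ->]; exists (fun i => a * g i).
by rewrite mulr_sumr; apply: eq_bigr => i _; rewrite mulrA.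
Qed.

Let I_F i : I (F i).
Proof.
exists (fun j => (j == i)%:R); rewrite (bigD1 i) //= eqxx mul1r big1 ?addr0 //.
by move=> j /negbTE ->; rewrite mul0r.
Qed.

(** Averaging over W turns a relation 1 = sum g_i (f_i - e_i) into one whose
    coefficients are invariants, that is, polynomials in the f_i. By algebraic
    independence it is an identity of polynomials, and it fails at the point e. *)
Let I_proper : ~ I 1.
Proof.
case=> g e1.
have rel v : \sum_i polyval (re_mpoly (g i)) v * (polyval (tnth f i) v - e i) = 1.
  have := congr1 (meval (fun i => (vcoord v i)%:C)) e1.
  rewrite meval1 rmorph_sum => /(congr1 Re) /= ->.
  rewrite Re_sum; apply: eq_bigr => i _; rewrite re_mpoly_val mevalM mevalB mevalC.
  rewrite meval_map_mpoly meval_real -rmorphB /=.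
  by case: (_.@[_]) => a b /=; rewrite mulr0 subr0.
pose N : R := #|` W|%:R.
have N0 : N != 0.
  by rewrite pnatr_eq0 cardfs_eq0; apply/eqP => h; have := group1W hW; rewrite h inE.
pose G i := N^-1 *: \sum_(w <- W) psubst w (re_mpoly (g i)).
have GE i v : polyval (G i) v = N^-1 * \sum_(w <- W) polyval (re_mpoly (g i)) (w v).
  rewrite /polyval mevalZ raddf_sum; congr (_ * _); apply: eq_bigr => w _.
  exact: psubst_val.
have Ginv i : invariant_poly W (G i).
  move=> w wW v; rewrite !GE; congr (_ * _).
  rewrite -[in RHS](perm_big _ (perm_mulW hW wW)) /= big_map.
  by apply: eq_bigr => w' _; rewrite comp_lfunE.
have [q hq] := boolp.choice (fun i => basic_gen hf (Ginv i)).
pose Q := 1 - \sum_i q i * ('X_i - (e i)%:MP).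
have : Q = 0.
  apply: (basic_indep hf); apply: mpoly_eq0_val => v.
  rewrite /Q rmorphB rmorph1 rmorph_sum /polyval mevalB meval1 rmorph_sum /=.
  apply/eqP; rewrite subr_eq0; apply/eqP.
  rewrite (eq_bigr (fun i => N^-1 * \sum_(w <- W) polyval (re_mpoly (g i)) (w v) *
      (polyval (tnth f i) (w v) - e i))) => [|i _]; last first.
    rewrite rmorphM rmorphB /= comp_mpolyXU comp_mpolyC -tnth_nth -hq.
    rewrite mevalM mevalB mevalC -!/(polyval _ _) GE -mulrA; congr (_ * _).
    rewrite mulr_suml big_seq [RHS]big_seq; apply: eq_bigr => w wW.
    by rewrite (basic_inv hf).
  rewrite -mulr_sumr exchange_big /= (eq_bigr (fun=> 1)) => [|w _]; last exact: rel.
  by rewrite big_const_seq count_predT iter_addr addr0 mulVf.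
move/(congr1 (meval e)); rewrite /Q mevalB meval1 meval0 rmorph_sum /= big1 => [/eqP|i _].
  by rewrite subr0 oner_eq0.
by rewrite mevalM mevalB mevalXU mevalC subrr mulr0.
Qed.

(** The product of the T - (X_k o w) over w has the root X_k, and its coefficients
    are invariants. These are polynomials in the f_i, and f_i is congruent to the
    constant e_i. *)
Let I_integral k :
  exists2 g : {poly R[i]}, g \is monic & I (map_poly (@mpolyC n R[i]) g).['X_k].
Proof.
pose T : {poly {mpoly R[n]}} := \prod_(w <- W) ('X - (lcoord w k)%:P).
have Tmon : T \is monic by apply: monic_prod => w _; exact: monicXsubC.
have Tinv j : invariant_poly W T`_j.
  move=> w wW v.
  have h u : polyval T`_j u = (\prod_(w <- W) ('X - (vcoord (w u) k)%:P))`_j.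
    rewrite /polyval -coef_map; suff -> : map_poly (meval (coord (vbasis {:V}) ^~ u)) T =
      \prod_(w' <- W) ('X - (vcoord (w' u) k)%:P) by [].
    rewrite rmorph_prod; apply: eq_bigr => w' _.
    by rewrite rmorphB /= map_polyX map_polyC /= -[meval _ _]/(polyval _ _) lcoord_val.
  rewrite !h -[in RHS](perm_big _ (perm_mulW hW wW)) /= big_map.
  suff -> : \prod_(w' <- W) ('X - (vcoord (w' (w v)) k)%:P) =
      \prod_(w' <- W) ('X - (vcoord ((w' \o w)%VF v) k)%:P) by [].
  by apply: eq_bigr => w' _; rewrite comp_lfunE.
have [q hq] := boolp.choice (fun j => basic_gen hf (Tinv j)).
pose t j : R[i] := mmap toC (fun i => (e i)%:C) (q j).
have ht j : I (map_mpoly toC T`_j - (t j)%:MP).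
  have -> : map_mpoly toC T`_j =
      mmap (@mpolyC n R[i] \o toC) (fun i => map_mpoly toC (tnth f i)) (q j).
    rewrite hq /comp_mpoly mmap_comp; apply: mmap_eq => // c /=; exact: map_mpolyC.
  have -> : (t j)%:MP = mmap (@mpolyC n R[i] \o toC) (fun i => ((e i)%:C)%:MP) (q j).
    by rewrite -[LHS]/((@mpolyC n R[i]) (mmap _ _ _)) mmap_comp; apply: mmap_eq.
  exact: ideal_cong_mmap.
pose N := (size T).-1.
have sT : size T = N.+1 by rewrite prednK // size_poly_gt0 monic_neq0.
have TE : T = 'X^N + \poly_(j < N) T`_j.
  rewrite -[LHS]coefK sT poly_def big_ord_recr /= addrC -poly_def; congr (_ + _).
  by have /monicP := Tmon; rewrite lead_coefE => ->; rewrite scale1r.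
have Troot : (map_poly (map_mpoly toC) T).['X_k] = 0.
  have [T' eT] : exists T', T = ('X - ('X_k)%:P) * T'.
    by rewrite /T (big_rem _ (group1W hW)) /= lcoord1; eexists.
  rewrite eT rmorphM hornerM rmorphB /=.
  have -> : map_poly (map_mpoly toC) ('X : {poly {mpoly R[n]}}) = 'X by apply: map_polyX.
  have -> : map_poly (map_mpoly toC) (('X_k : {mpoly R[n]})%:P) = ('X_k)%:P.
    rewrite map_polyC; congr (_%:P); exact: map_mpolyX.
  by rewrite hornerXsubC subrr mul0r.
exists ('X^N + \poly_(j < N) t j).
  rewrite monicE lead_coefDl ?lead_coefXn //.
  by rewrite size_polyXn ltnS size_poly.
have -> : (map_poly (@mpolyC n R[i]) ('X^N + \poly_(j < N) t j)).['X_k] =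
    'X_k ^+ N + \sum_(j < N) (t j)%:MP * 'X_k ^+ j.
  rewrite rmorphD /= map_polyXn hornerD hornerXn; congr (_ + _).
  rewrite poly_def rmorph_sum horner_sum; apply: eq_bigr => j _.
  by rewrite -mul_polyC rmorphM /= map_polyC map_polyXn hornerM hornerC hornerXn.
have e0 : 'X_k ^+ N + \sum_(j < N) map_mpoly toC T`_j * 'X_k ^+ j = 0.
  transitivity (map_poly (map_mpoly toC) T).['X_k]; last exact: Troot.
  rewrite [in RHS]TE rmorphD /= map_polyXn hornerD hornerXn; congr (_ + _).
  rewrite poly_def rmorph_sum horner_sum; apply: eq_bigr => j _.
  by rewrite -mul_polyC rmorphM /= map_polyC map_polyXn hornerM hornerC hornerXn.
rewrite -[X in I X]subr0 -[X in _ - X]e0 opprD addrACA subrr add0r -sumrB.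
apply: ideal_sum => // j; rewrite -mulrBl mulrC; have [_ _ hM] := I_ideal; apply: hM.
by rewrite -opprB; apply: idealN.
Qed.

(** Otherwise the f_i - e_i would generate the unit ideal. *)
Lemma basic_point : exists x, forall i, cpolyval (tnth f i) x = (e i)%:C.
Proof.
have [z hz] := integral_nullstellensatz I_ideal I_proper I_integral.
exists (\sum_i Re (z i) *: e_ i, \sum_i Im (z i) *: e_ i) => i.
have := hz _ (I_F i); rewrite /F mevalB mevalC meval_map_mpoly => /eqP.
rewrite subr_eq0 => /eqP <-; apply: mmap_eq => // j.
by rewrite /ccoord /= !vcoord_comb; case: (z j).
Qed.

End BasicPoint.

(** * The number of roots *)

Lemma prim_root_ex (C : closedFieldType) k : k%:R != 0 :> C -> (0 < k)%N ->
  exists z : C, k.-primitive_root z.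
Proof.
move=> kC k0; have [rs ers] := closed_field_poly_normal ('X^k - 1 : {poly C}).
have lc : lead_coef ('X^k - 1 : {poly C}) = 1 by apply/monicP/monicXnsubC.
rewrite lc scale1r in ers.
have : has k.-primitive_root rs.
  apply: cyclic.has_prim_root => //.
  - by apply/allP => z zrs; rewrite /root_of_unity ers root_prod_XsubC.
  - by rewrite -separable_prod_XsubC -ers cyclotomic.separable_Xn_sub_1.
  - by rewrite -ltnS -(size_prod_XsubC _ id) -ers size_XnsubC.
by case/hasP => z _ zp; exists z.
Qed.

Section Main.
Variables (R : rcfType) (V : vectType R) (B : {dot V for idfun}).
Variables (W : {fset 'End(V)}) (Phi : {fset V}) (h : nat).
Hypotheses (hW : finite_reflection_group B W) (hPhi : root_system_of B W Phi).
Hypothesis hirr : irreducible_roots B Phi.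
Hypothesis hspan : <<Phi>>%VS = fullv.
Hypothesis hh : Coxeter_number W h.

Lemma root_count_le x : (root_count B Phi x <= #|` Phi|)%N.
Proof. by apply/fsubset_leq_card/fsubsetP => a; rewrite in_support => /andP[]. Qed.

Lemma root_count_regular x : {in Phi, forall a, cval B a x != 0} ->
  root_count B Phi x = #|` Phi|.
Proof.
move=> hx; congr (#|` _|); apply/fsetP => a; rewrite in_support.
by apply: andb_idr => /hx.
Qed.

Lemma dim_gt0 : (0 < \dim {:V})%N.
Proof.
have [/fset0Pn[a aP] _] := hirr; rewrite lt0n dimv_eq0.
apply: contraTneq (memvf a) => ->; rewrite memv0; exact: (root_neq0 hPhi).
Qed.

(** The eigenvalue of a Coxeter element has an order b that divides a degree, so
    the number of roots is at most b n <= h n. Conversely, let x be a point where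
    all basic invariants except the last vanish. Multiplying x by a primitive
    h-th root of unity does not change the basic invariants, so the product is in
    the orbit of x; thus x is an eigenvector to which root_count_bound applies. *)
Lemma card_roots : #|` Phi| = (h * \dim {:V})%N.
Proof.
have [d [dsorted [f hf]] hE] := hh; have n0 := dim_gt0.
have hlast : ((\dim {:V}).-1 < \dim {:V})%N by rewrite ltn_predL.
pose m := Ordinal hlast.
have hm : h = tnth d m by rewrite hE -nth_last size_tuple (tnth_nth 0%N).
have hmax i : (tnth d i <= h)%N.
  rewrite hm !(tnth_nth 0%N); apply: (sorted_leq_nth leq_trans leqnn) => //.
  - by rewrite inE size_tuple.
  - by rewrite inE size_tuple.
  - by rewrite /= -ltnS prednK.
have h0 : (0 < h)%N by rewrite hm (degree_gt0 hf).
apply/eqP; rewrite eqn_leq; apply/andP; split.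
  have [c [x [l [b [cW lp x0 cx hcard]]]]] := coxeter_bound hW hPhi hirr hspan.
  have [i hi] := eigen_order_dvd hW hf lp x0 cW cx.
  apply: leq_trans hcard _; rewrite leq_mul2r (leq_trans _ (hmax i)) ?orbT //.
  by apply: dvdn_leq hi; apply: (degree_gt0 hf).
have [x hx] := basic_point hW hf (fun i => (i == m)%:R).
have [l lp] : exists l : R[i], h.-primitive_root l.
  by apply: prim_root_ex; rewrite // pnatr_eq0 -lt0n.
have x0 : x != 0.
  apply: contra_eq_neq (hx m) => ->.
  by rewrite (basic_at0 hf) eqxx eq_sym oner_eq0.
have [i|w wW wx] := @invariants_separate _ _ B _ hW _ _ hf x (l *: x).
  rewrite (cpolyval_homog _ _ (basic_homog hf i)) hx.
  have [->|_] := eqVneq i m; last by rewrite mulr0.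
  by rewrite -hm (prim_expr_order lp) mul1r.
have [hb _] := root_count_bound hW hPhi hirr hspan lp x0 wW wx.
exact: leq_trans hb (root_count_le x).
Qed.

End Main.

Theorem theorem2 (R : realType) (V : vectType R) (B : {dot V for idfun})
    (W : {fset 'End(V)}) (Phi : {fset V}) (h b : nat)
    (x : complexification V)
    (hW : finite_reflection_group B W)
    (hPhi : root_system_of B W Phi)
    (hirr : irreducible_roots B Phi)
    (hspan : <<Phi>>%VS = fullv)
    (hh : Coxeter_number W h)
    (hb : (0 < b)%N)
    (hx0 : x != 0)
    (hx : exists2 w, w \in W &
          exists2 lambda : R[i], b.-primitive_root lambda &
            cextend w x = lambda *: x) :
  (b * \dim {:V} <= root_count B Phi x)%N /\
  (root_count B Phi x = (b * \dim {:V})%N <-> b = h).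
Proof.
have [w wW [l lp wx]] := hx.
have [bound eqreg] := root_count_bound hW hPhi hirr hspan lp hx0 wW wx.
have card := card_roots hW hPhi hirr hspan hh.
split=> //; split=> [e|bh].
  apply/eqP; rewrite -(eqn_pmul2r (dim_gt0 hPhi hirr)) -card -e.
  by rewrite root_count_regular //; apply: eqreg.
by apply/eqP; rewrite eqn_leq bound andbT bh -card root_count_le.
Qed.
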